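(* Let $\gamma$ be a penalty function satisfying the standing assumptions (A0)–(A3) of the context, and let $f:\Omega\times\mathbb{R}\to(-\infty,\infty]$ be a proper normal convex integrand. If $f(\cdot,x)^+\in M^{\rho_\gamma}_u$ for all $x\in\mathbb{R}$, and $f^*(\cdot,\eta_0)^+\in L^{\rho_\gamma}$ for some $\eta_0\in L^{\rho_\gamma}$, then for any nonempty convex set $\mathcal{C}\subset L^\infty$, $$\inf_{\xi\in\mathcal{C}}\mathcal{I}_{f,\gamma}(\xi)=-\min_{\eta\in L^1}\Bigl(\mathcal{H}_{f^*,\gamma}(-\eta)+\sup_{\xi'\in\mathcal{C}}\mathbb{E}[\xi'\eta]\Bigr).$$ If in addition $\mathcal{C}$ is a convex cone, the right hand side is equal to $-\min_{\eta\in\mathcal{C}^\circ}\mathcal{H}_{f^*,\gamma}(-\eta)$, where $\mathcal{C}^\circ=\{\eta\in L^1:\mathbb{E}[\xi\eta]\le1,\ \forall\xi\in\mathcal{C}\}$.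
   Context: **Probability space.** $(\Omega,\mathcal{F},\mathbb{P})$ is a complete probability space; $L^0$ is the space of ($\mathbb{P}$-a.s. classes of) real random variables and $L^p=L^p(\Omega,\mathcal{F},\mathbb{P})$. ''A.s.'' and identification of random variables always refer to $\mathbb{P}$; $\mathbb{E}$ is $\mathbb{P}$-expectation, $\mathbb{E}_Q$ is $Q$-expectation. $\mathcal{Q}$ is the set of probability measures $Q\ll\mathbb{P}$ on $\mathcal{F}$, identified with $\{\eta\in L^1:\eta\ge0,\ \mathbb{E}[\eta]=1\}$ via $Q\mapsto dQ/d\mathbb{P}$. For $Q\in\mathcal{Q}$, $L^1(Q)=\{\xi\in L^0:\mathbb{E}_Q[|\xi|]<\infty\}$. **Penalty function.** $\gamma:\mathcal{Q}\to[0,\infty]$ satisfies: (A0) $\gamma$ is proper, convex and $\sigma(L^1,L^\infty)$-lower semicontinuous; (A1) $\inf_{Q\in\mathcal{Q}}\gamma(Q)=0$; (A2) there is $Q_0\in\mathcal{Q}$ with $Q_0\sim\mathbb{P}$ and $\gamma(Q_0)<\infty$; (A3) $\{Q\in\mathcal{Q}:\gamma(Q)\le1\}$ is $\sigma(L^1,L^\infty)$-compact. $\mathcal{Q}_\gamma:=\{Q\in\mathcal{Q}:\gamma(Q)<\infty\}$. Set $\rho_\gamma(\xi):=\sup_{Q\in\mathcal{Q}_\gamma}(\mathbb{E}_Q[\xi]-\gamma(Q))$ for $\xi\in L^0$ with $\xi^-\in\bigcap_{Q\in\mathcal{Q}_\gamma}L^1(Q)$, and $$L^{\rho_\gamma}=\{\xi\in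 L^0:\exists\alpha>0,\ \rho_\gamma(\alpha|\xi|)<\infty\},$$ $$M^{\rho_\gamma}_u=\{\xi\in L^0:\forall\alpha>0,\ \lim_{N\to\infty}\rho_\gamma(\alpha|\xi|\mathbf{1}_{\{|\xi|>N\}})=0\}.$$ **Integrand and functionals.** $f$ is a proper normal convex integrand: $f$ is $\mathcal{F}\otimes\mathcal{B}(\mathbb{R})$-measurable and $f(\omega,\cdot)$ is a lower semicontinuous proper convex function for a.e. $\omega$. $f(\cdot,\xi)$ denotes $\omega\mapsto f(\omega,\xi(\omega))$, and $f^*(\omega,y):=\sup_{x\in\mathbb{R}}(xy-f(\omega,x))$. For $\xi\in L^\infty$, $\mathcal{I}_{f,\gamma}(\xi):=\sup_{Q\in\mathcal{Q}_\gamma}(\mathbb{E}_Q[f(\cdot,\xi)]-\gamma(Q))$. With $\mathrm{dom}f(\omega,\cdot)=\{x:f(\omega,x)<\infty\}$, set for $y\in\mathbb{R}$, $z\ge0$ $$\tilde f^*(\omega,y,z):=\sup_{x\in\mathrm{dom}f(\omega,\cdot)}(xy-zf(\omega,x)).$$ For $\eta\in L^1$, $Q\in\mathcal{Q}_\gamma$: $\mathcal{H}_{f^*}(\eta|Q):=\mathbb{E}[\tilde f^*(\cdot,\eta,dQ/d\mathbb{P})]$ and $\mathcal{H}_{f^*,\gamma}(\eta):=\inf_{Q\in\mathcal{Q}_\gamma}(\mathcal{H}_{f^*}(\eta|Q)+\gamma(Q))$. ''$\min$'' means that the infimum is attained (the value $+\infty$ being allowed). *)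

(* Defs.v *)
From HB Require Import structures.
From mathcomp Require Import all_boot all_order all_algebra.
From mathcomp Require Import all_classical all_reals all_analysis.
From mathcomp Require Import measurable_realfun.

Set Implicit Arguments.
Unset Strict Implicit.
Unset Printing Implicit Defensive.

Import Order.TTheory GRing.Theory Num.Theory.
Import numFieldNormedType.Exports.

Local Open Scope classical_set_scope.
Local Open Scope ring_scope.
Local Open Scope charge_scope.
Local Open Scope ereal_scope.

(* Random variables are represented by measurable functions rather than by
   their P-a.s. classes; every notion below is invariant under P-a.s. equality
   of its arguments. In particular, lower semicontinuity below forces a penalty
   function to agree on probability measures with a.s. equal densities. *)

Notation L1 P := (LfunType P (@lexx _ _ 1)).
Notation Linf P := (LfunType P (@leey _ 1)).

Section spaces.
Context {d : measure_display} {T : measurableType d} {R : realType}.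
Variable P : probability T R.

Definition pairing (eta : L1 P) : {ptws Linf P -> R} :=
  fun xi : Linf P => fine ('E_P[(xi \* eta)%R]).

(* L1 with the topology sigma(L1, Linf) *)
Definition weakL1 : topologicalType := initial_topology pairing.

(* the set of probability measures Q << P *)
Definition acprob : Type := {Q : probability T R | Q `<< P}.
HB.instance Definition _ := gen_eqMixin acprob.
HB.instance Definition _ := gen_choiceMixin acprob.

Definition acprob_prob (Q : acprob) : probability T R := sval Q.
Coercion acprob_prob : acprob >-> probability.

Definition dens_fun (Q : acprob) : T -> R :=
  fine \o 'd (charge_of_finite_measure Q) '/d P.

Lemma dens_fun_Lfun (Q : acprob) : dens_fun Q \in Lfun P 1.
Proof.
have QP : charge_of_finite_measure Q `<< P by exact: (svalP Q).
apply/Lfun1_integrable.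
have -> : EFin \o dens_fun Q = 'd (charge_of_finite_measure Q) '/d P.
  by apply/funext => w /=; rewrite fineK// Radon_Nikodym_fin_num.
exact: Radon_Nikodym_integrable.
Qed.

(* dQ/dP *)
Definition dens (Q : acprob) : L1 P := Lfun_Sub (lexx 1) (dens_fun_Lfun Q).

(* the set of all Q << P, with the topology sigma(L1, Linf) transported along
   Q |-> dQ/dP *)
Definition wacprob : topologicalType :=
  initial_topology (fun Q : acprob => dens Q : weakL1).

End spaces.

Section penalty.
Context {d : measure_display} {T : measurableType d} {R : realType}.
Variables (P : probability T R) (gamma : acprob P -> \bar R).

(* [probability T R] has no convex structure, so that convex combinations
   are given by their values on measurable sets. *)
Definition acprob_convex :=
  forall (Q1 Q2 Q : acprob P) (t : R), (0 <= t <= 1)%R ->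
    (forall A, measurable A -> Q A = t%:E * Q1 A + (1 - t)%:E * Q2 A) ->
    gamma Q <= t%:E * gamma Q1 + (1 - t)%:E * gamma Q2.

Record penalty : Prop := {
  penalty_ge0 : forall Q, 0 <= gamma Q;
  penalty_proper : exists Q, gamma Q < +oo;
  penalty_convex : acprob_convex;
  penalty_lsc : lower_semicontinuous (gamma : wacprob P -> \bar R);
  penalty_inf : ereal_inf [set gamma Q | Q in [set: acprob P]] = 0;
  (* Q0 << P is part of the type *)
  penalty_equiv : exists Q0 : acprob P, P `<< Q0 /\ gamma Q0 < +oo;
  penalty_compact : compact [set Q : wacprob P | gamma Q <= 1]
}.

Definition Qgamma : set (acprob P) := [set Q | gamma Q < +oo].

Definition rho (xi : T -> R) : \bar R :=
  ereal_sup [set 'E_(Q : acprob P)[xi] - gamma Q | Q in Qgamma].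

Definition Lrho : set {mfun T >-> R} :=
  [set xi | exists2 alpha : R, (0 < alpha)%R &
    rho (fun w => alpha * `|xi w|)%R < +oo].

Definition Mrho_u : set {mfun T >-> R} :=
  [set xi | forall alpha : R, (0 < alpha)%R ->
    rho (fun w => alpha * `|xi w| * \1_[set v | N%:R < `|xi v|] w)%R
      @[N --> \oo] --> 0].

(* the extended real-valued function g agrees a.s. with an element of A *)
Definition ae_in (A : set {mfun T >-> R}) (g : T -> \bar R) :=
  exists2 xi, A xi & \forall w \ae P, g w = (xi w)%:E.

End penalty.

Section integrand.
Context {d : measure_display} {T : measurableType d} {R : realType}.
Variables (P : probability T R) (f : T -> R -> \bar R).

Definition econvex (h : R -> \bar R) :=
  forall (x y t : R), (0 <= t <= 1)%R ->
    h (t * x + (1 - t) * y)%R <= t%:E * h x + (1 - t)%:E * h y.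

Record normal_convex_integrand : Prop := {
  integrand_gtNy : forall w x, -oo < f w x;
  integrand_measurable :
    measurable_fun [set: T * R] (fun p => f p.1 p.2);
  integrand_proper : \forall w \ae P, exists x, f w x < +oo;
  integrand_convex : \forall w \ae P, econvex (f w);
  integrand_lsc : \forall w \ae P, lower_semicontinuous (f w)
}.

Definition fconj (w : T) (y : R) : \bar R :=
  ereal_sup [set (x * y)%:E - f w x | x in [set: R]].

Definition conj_tilde (w : T) (y z : R) : \bar R :=
  ereal_sup [set (x * y)%:E - z%:E * f w x | x in [set x | f w x < +oo]].

Variable gamma : acprob P -> \bar R.

Definition Ifun (xi : Linf P) : \bar R :=
  ereal_sup [set \int[Q]_w f w (xi w) - gamma Q | Q in Qgamma gamma].

Definition Hcond (eta : L1 P) (Q : acprob P) : \bar R :=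
  \int[P]_w conj_tilde w (eta w) (dens Q w).

Definition Hfun (eta : L1 P) : \bar R :=
  ereal_inf [set Hcond eta Q + gamma Q | Q in Qgamma gamma].

End integrand.

Section sets.
Context {d : measure_display} {T : measurableType d} {R : realType}.
Variable P : probability T R.

(* The multiplier 0 is not required: a cone may or may not contain 0. *)
Definition cone (C : set (Linf P)) :=
  forall (t : R) xi, (0 < t)%R -> C xi -> C (t *: xi)%R.

Definition support_fun (C : set (Linf P)) (eta : L1 P) : \bar R :=
  ereal_sup [set 'E_P[(xi \* eta)%R] | xi in C].

Definition polar (C : set (Linf P)) : set (L1 P) :=
  [set eta | forall xi, C xi -> 'E_P[(xi \* eta)%R] <= 1].

End sets.

(* m is the infimum of F over A and is attained (m = +oo being allowed) *)
Definition is_min {S : Type} {R : realType} (A : set S) (F : S -> \bar R)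
    (m : \bar R) :=
  ereal_inf [set F x | x in A] = m /\ exists2 x, A x & F x = m.

(* Main.v *)
Require Import Defs.
From HB Require Import structures.
From mathcomp Require Import all_boot all_order all_algebra.
From mathcomp Require Import all_classical all_reals all_analysis.
From mathcomp Require Import measurable_realfun ess_sup_inf.
From mathcomp Require Import ring lra.

Set Implicit Arguments.
Unset Strict Implicit.
Unset Printing Implicit Defensive.

Import Order.TTheory GRing.Theory Num.Theory.
Import numFieldNormedType.Exports.

Local Open Scope classical_set_scope.
Local Open Scope ring_scope.
Local Open Scope charge_scope.

(** The identity is a minimax theorem on a weakly compact set.

    Since f(.,x)^+ is finite for every x, almost every f(w,.) is a finite convex
    function, so that f may be replaced by a real-valued integrand g
    ([exists_finite_integrand]).  Put J(xi,Q) = E_Q[g(.,xi)] for xi in Linf and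
    for Q of finite penalty.  Two facts relate J to the conjugate functional:
    - H(eta|Q) is the supremum over xi in Linf of E[xi eta] - J(xi,Q), because the
      pointwise supremum defining the conjugate runs over rational points and is
      approached by bounded measurable selections ([Hcond_ge], [Hcond_le]);
    - for fixed xi and Q the supremum over eta of -E[xi eta] - H(-eta|Q) is
      J(xi,Q), attained where -eta is the density of Q times the right derivative
      of g at xi ([exists_subgradient]).
    Hence I(xi) is the supremum over (eta,Q) of
      K(xi,eta,Q) = -E[xi eta] - H(-eta|Q) - gamma(Q),
    which is affine in xi and concave in (eta,Q), and the theorem says that the
    infimum over xi and the supremum over (eta,Q) commute and that the latter is
    attained.  Applying the minimax argument to K, rather than to I on Linf, keeps
    everything in L1: no singular functional on Linf ever appears.

    Let m be smaller than the infimum of I over C.  For finitely many xi in C, some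
    (eta,Q) gives K > m for all of them at once ([finite_minimax]); it remains to
    find one that works for all xi in C, by compactness.  On a superlevel set of K
    the penalties are bounded ([level_penalty_bounded]), and comparing xi0 with
    xi0 - k sgn(eta) 1_A bounds k E[|eta| 1_A] by a constant independent of k and A
    plus a multiple of Q(A) ([level_density_bound]).  Sublevel sets of the penalty
    are uniformly countably additive, by a Dini argument on the compact set
    {gamma <= 1} ([penalty_sublevel_tail]), hence so are the eta, and along any
    ultrafilter both eta and Q converge weakly ([dunford_pettis],
    [penalty_ultralimit]).  K is upper semicontinuous at the limit: H(-eta|Q)
    is a supremum over xi of -E[xi eta] - J(xi,Q), where the first term is
    continuous in eta, gamma is lower semicontinuous, and Q -> J(xi,Q) is upper
    semicontinuous on sublevel sets, because M^rho_u controls the excess of g(.,xi)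
    over large constants uniformly in Q ([excess_controlled_usc]).  The limit
    point is optimal ([dual_attained]).

    The converse inequality is the Fenchel-Young inequality ([weak_duality]).  If
    the infimum is -oo, weak duality makes every eta a minimizer of value +oo.  For
    a cone, the support function is 0 on the polar and +oo off it. *)

(** * Minimax for finitely many functions *)

Section minimax.
Context {R : realType}.

(** Suppose that no point has both values above m.  A point witnessing that a
    weighted sum exceeds m then has exactly one of u, v above m, and by continuity
    it still is a witness for nearby weights.  At the supremum s of the weights
    with a witness of the second kind, every witness is of the first kind, so that
    some weight just below s has witnesses of both kinds; the segment between them
    crosses the quadrant where u and v exceed m. *)
Lemma two_function_minimax (Z : Type) (D : set Z) (u v : Z -> R) (m : R) :
  (forall z1 z2 t, D z1 -> D z2 -> 0 <= t <= 1 ->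
    exists z, [/\ D z, t * u z1 + (1 - t) * u z2 <= u z &
                  t * v z1 + (1 - t) * v z2 <= v z]) ->
  (forall l, 0 <= l <= 1 -> exists2 z, D z & m < l * u z + (1 - l) * v z) ->
  exists z, [/\ D z, m < u z & m < v z].
Proof.
move=> Dconv Dl; apply: contrapT => none.
have uv z : D z -> m < u z -> v z <= m.
  by move=> Dz uz; rewrite leNgt; apply/negP => vz; apply: none; exists z.
pose S := [set l | 0 <= l <= 1 /\
  exists z, [/\ D z, m < v z & m < l * u z + (1 - l) * v z]].
have S0 : S 0.
  split; first by rewrite lexx ler01.
  have [|z Dz] := Dl 0; first by rewrite lexx ler01.
  by move=> mz; exists z; split => //; lra.
have Sub1 : ubound S 1 by move=> l [/andP[]].
have Shs : has_sup S by split; [exists 0|exists 1].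
set s := sup S.
have s0 : 0 <= s by apply: ub_le_sup => //; exists 1.
have s1 : s <= 1 by apply: ge_sup => //; exists 0.
have [|z Dz mz] := Dl s; first by rewrite s0.
have [vz|vz] := ltP m (v z).
  have uz : u z <= m by rewrite leNgt; apply/negP => /uv -/(_ Dz); rewrite leNgt vz.
  have sn1 : s < 1.
    rewrite lt_neqAle s1 andbT; apply/eqP => s1E.
    by move: mz; rewrite s1E; lra.
  (* room to the right of s, contradicting the choice of s as a supremum *)
  pose e := (s * u z + (1 - s) * v z - m) / (v z - u z).
  have e0 : 0 < e by rewrite divr_gt0//; lra.
  have eE : e * (v z - u z) = s * u z + (1 - s) * v z - m.
    by rewrite divfK// gt_eqF//; lra.
  pose l := s + Num.min (e / 2) (1 - s).
  have ml : 0 < Num.min (e / 2) (1 - s) by rewrite lt_min divr_gt0//=; lra.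
  have : S l.
    split.
      have : Num.min (e / 2) (1 - s) <= 1 - s by rewrite ge_min lexx orbT.
      by rewrite /l; lra.
    exists z; split => //.
    have h : Num.min (e / 2) (1 - s) <= e / 2 by rewrite ge_min lexx.
    rewrite /l; set q := Num.min _ _ in h ml *.
    have : q * (v z - u z) <= e / 2 * (v z - u z) by apply: ler_wpM2r; lra.
    by nra.
  by move=> /(ub_le_sup (ex_intro _ 1 Sub1)); rewrite -/s /l; lra.
have uz : m < u z by nra.
pose e := (s * u z + (1 - s) * v z - m) / (u z - v z).
have e0 : 0 < e by rewrite divr_gt0//; lra.
have eE : e * (u z - v z) = s * u z + (1 - s) * v z - m.
  by rewrite divfK// gt_eqF//; lra.
have [l [/andP[l0 l1] [z' [Dz' vz' mz']]] le] := sup_adherent e0 Shs.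
rewrite -/s in le.
have ls : l <= s by apply: ub_le_sup; [exists 1|split; [rewrite l0|exists z']].
have uz' : u z' <= m.
  by rewrite leNgt; apply/negP => /uv -/(_ Dz'); rewrite leNgt vz'.
have lz : m < l * u z + (1 - l) * v z.
  have : (s - l) * (u z - v z) < e * (u z - v z) by rewrite ltr_pM2r; lra.
  by nra.
pose a := u z - m; pose b := m - v z; pose c := v z' - m; pose f := m - u z'.
have a0 : 0 < a by rewrite /a; lra.
have b0 : 0 <= b by rewrite /b; lra.
have c0 : 0 < c by rewrite /c; lra.
have f0 : 0 <= f by rewrite /f; lra.
have h1 : (1 - l) * b < l * a by rewrite /a /b; nra.
have h2 : l * f < (1 - l) * c by rewrite /c /f; nra.
have lp : 0 < l.
  by rewrite lt_neqAle l0 andbT; apply/eqP => l0E; move: h1; rewrite -l0E; lra.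
have lp1 : 0 < 1 - l.
  rewrite lt_neqAle; apply/andP; split; last by lra.
  by apply/eqP => l0E; move: h2; rewrite -l0E; nra.
have bf : b * f < a * c.
  have k1 : (1 - l) * c * ((1 - l) * b) < (1 - l) * c * (l * a).
    by rewrite ltr_pM2l// mulr_gt0.
  have k2 : (1 - l) * b * (l * f) <= (1 - l) * b * ((1 - l) * c).
    by rewrite ler_wpM2l// ?mulr_ge0//; lra.
  have : l * (1 - l) * (b * f) < l * (1 - l) * (a * c) by nra.
  by rewrite ltr_pM2l// mulr_gt0.
have abcf : 0 < a + b + c + f by lra.
pose t := (c + f) / (a + b + c + f).
have tE : t * (a + b + c + f) = c + f by rewrite divfK// gt_eqF.
have t0 : 0 <= t by rewrite divr_ge0//; lra.
have t1 : t <= 1 by rewrite ler_pdivrMr// mul1r; lra.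
have [|y [Dy uy vy]] := Dconv z z' t Dz Dz'; first by rewrite t0.
apply: none; exists y; split => //.
- apply: lt_le_trans uy; rewrite -subr_gt0.
  rewrite -(pmulr_lgt0 _ abcf).
  have -> : (t * u z + (1 - t) * u z' - m) * (a + b + c + f) =
    a * (t * (a + b + c + f)) - f * ((a + b + c + f) - t * (a + b + c + f)).
    by rewrite /a /f; ring.
  by rewrite tE; nra.
- apply: lt_le_trans vy; rewrite -subr_gt0.
  rewrite -(pmulr_lgt0 _ abcf).
  have -> : (t * v z + (1 - t) * v z' - m) * (a + b + c + f) =
    c * ((a + b + c + f) - t * (a + b + c + f)) - b * (t * (a + b + c + f)).
    by rewrite /b /c; ring.
  by rewrite tE; nra.
Qed.

(** Induction on the list: imposing k i > m on the points preserves the concavity of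
    the family, and the two-function case shows that it preserves the hypothesis
    that every single function exceeds m somewhere.  Concavity is
    expressed by the existence of points dominating the convex combinations of
    values, which is stable under passing to superlevel sets and lets Z be a type
    of tuples without linear structure. *)
Lemma finite_minimax (I : eqType) (Z : Type) (C : set I) (k : I -> Z -> R)
    (m : R) (s : seq I) (D : set Z) :
  (forall i j t, C i -> C j -> 0 <= t <= 1 ->
    exists2 l, C l & forall z, D z -> k l z <= t * k i z + (1 - t) * k j z) ->
  (forall z1 z2 t, D z1 -> D z2 -> 0 <= t <= 1 ->
    exists2 z, D z & forall i, t * k i z1 + (1 - t) * k i z2 <= k i z) ->
  (forall i, C i -> exists2 z, D z & m < k i z) ->
  D !=set0 -> (forall i, i \in s -> C i) ->
  exists2 z, D z & forall i, i \in s -> m < k i z.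
Proof.
elim: s D => [|i s ih] D Ccvx Dccv Csup [z0 Dz0] sC; first by exists z0.
have Ci : C i by apply: sC; rewrite inE eqxx.
have [| | | | |z [Dz mz] sz] := ih [set z | D z /\ m < k i z].
- move=> j l t Cj Cl t01; have [h Ch hk] := Ccvx j l t Cj Cl t01.
  by exists h => // z [Dz _]; exact: hk.
- move=> z1 z2 t [Dz1 m1] [Dz2 m2] t01.
  have [z Dz kz] := Dccv z1 z2 t Dz1 Dz2 t01.
  exists z => //; split => //; apply: lt_le_trans (kz i).
  move/andP: t01 => [t0 t1].
  have mp : m < Num.min (k i z1) (k i z2) by rewrite lt_min m1.
  apply: lt_le_trans mp _.
  have p1 : Num.min (k i z1) (k i z2) <= k i z1 by rewrite ge_min lexx.
  have p2 : Num.min (k i z1) (k i z2) <= k i z2 by rewrite ge_min lexx orbT.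
  by nra.
- move=> j Cj; have [| |z [Dz iz jz]] := @two_function_minimax _ D (k i) (k j) m.
  + move=> z1 z2 t Dz1 Dz2 t01; have [z Dz kz] := Dccv z1 z2 t Dz1 Dz2 t01.
    by exists z; split.
  + move=> l l01; have [h Ch hk] := Ccvx i j l Ci Cj l01.
    by have [z Dz mz] := Csup h Ch; exists z => //; exact: lt_le_trans (hk z Dz).
  + by exists z.
- by have [z Dz mz] := Csup i Ci; exists z.
- by move=> j js; apply: sC; rewrite inE js orbT.
by exists z => // j; rewrite inE => /predU1P[->//|/sz].
Qed.

End minimax.

(** * Real-valued integrals under a probability *)

Notation itg mu X := (integrable mu setT (EFin \o X)).
Notation Ex mu X := (Rintegral mu setT X).

Section real_integrals.
Context {d : measure_display} {T : measurableType d} {R : realType}.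
Variable mu : probability T R.
Implicit Types X Y : T -> R.

Lemma probability_measure_setT : (mu : {measure set T -> \bar R}) setT = 1%E.
Proof. exact: probability_setT. Qed.

Lemma itg_measurable X : itg mu X -> measurable_fun setT X.
Proof. by move=> /measurable_int/measurable_EFinP. Qed.

Lemma itg_dominated X Y : measurable_fun setT X -> itg mu Y ->
  (\forall w \ae mu, `|X w| <= Y w) -> itg mu X.
Proof.
move=> mX iY XY; have mY := itg_measurable iY.
case/integrableP: iY => _ iY; apply/integrableP; split; first exact/measurable_EFinP.
apply: le_lt_trans iY; apply: ae_ge0_le_integral => //.
- by apply: measurableT_comp => //; exact/measurable_EFinP.
- by apply: measurableT_comp => //; exact/measurable_EFinP.
- apply: filterS XY => w XYw _ /=; rewrite lee_fin.
  by apply: le_trans XYw _; exact: ler_norm.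
Qed.

Lemma itg_cst c : itg mu (fun=> c).
Proof. exact: finite_measure_integrable_cst. Qed.

Lemma itgD X Y : itg mu X -> itg mu Y -> itg mu (fun w => X w + Y w).
Proof. by move=> iX iY; exact: (integrableD measurableT iX iY). Qed.

Lemma itgZ c X : itg mu X -> itg mu (fun w => c * X w).
Proof. by move=> iX; exact: (integrableZl measurableT c iX). Qed.

Lemma itgN X : itg mu X -> itg mu (fun w => - X w).
Proof.
move=> /(itgZ (-1)); rewrite (_ : (fun w => -1 * X w) = (fun w => - X w))//.
by apply/funext => w; rewrite mulN1r.
Qed.

Lemma itgB X Y : itg mu X -> itg mu Y -> itg mu (fun w => X w - Y w).
Proof. by move=> iX iY; apply: itgD => //; exact: itgN. Qed.

Lemma itg_norm X : itg mu X -> itg mu (fun w => `|X w|).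
Proof. exact: integrable_norm. Qed.

Lemma itg_bounded X M : measurable_fun setT X ->
  (\forall w \ae mu, `|X w| <= M) -> itg mu X.
Proof. by move=> mX XM; exact: (itg_dominated mX (itg_cst M)). Qed.

Lemma itgM X Y M : measurable_fun setT X -> (\forall w \ae mu, `|X w| <= M) ->
  itg mu Y -> itg mu (fun w => X w * Y w).
Proof.
move=> mX XM iY.
apply: (@itg_dominated _ (fun w => M * `|Y w|)); last 1 first.
- by apply: filterS XM => w XMw; rewrite normrM ler_wpM2r.
- exact: measurable_funM (itg_measurable iY).
- by apply: itgZ; exact: itg_norm.
Qed.

Lemma itg_indic A X : measurable A -> itg mu X -> itg mu (fun w => \1_A w * X w).
Proof.
move=> mA iX; apply: (@itgM _ _ 1) => //; apply: nearW => w.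
by rewrite indicE; case: (w \in A); rewrite ?normr1 ?normr0.
Qed.

Lemma ae_le_Ex X Y : itg mu X -> itg mu Y ->
  (\forall w \ae mu, X w <= Y w) -> Ex mu X <= Ex mu Y.
Proof.
move=> iX iY XY; rewrite -subr_ge0 -RintegralB//.
rewrite -lee_fin /Rintegral fineK; last first.
  by apply: integrable_fin_num => //; exact: itgB.
have mYX := itg_measurable (itgB iY iX).
rewrite (@ae_eq_integral _ _ _ mu setT (fun w => (Num.max 0 (Y w - X w))%:E))//.
- by apply: integral_ge0 => w _; rewrite lee_fin le_max lexx.
- exact/measurable_EFinP.
- by apply/measurable_EFinP; exact: measurable_maxr.
- apply: filterS XY => w XYw _; congr EFin.
  by apply/esym/max_idPr; rewrite subr_ge0.
Qed.

Lemma ae_eq_Ex X Y : measurable_fun setT X -> measurable_fun setT Y ->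
  (\forall w \ae mu, X w = Y w) -> Ex mu X = Ex mu Y.
Proof.
move=> mX mY XY; congr fine; apply: ae_eq_integral => //.
- exact/measurable_EFinP.
- exact/measurable_EFinP.
- by apply: filterS XY => w ->.
Qed.

Lemma ExD X Y : itg mu X -> itg mu Y ->
  Ex mu (fun w => X w + Y w) = Ex mu X + Ex mu Y.
Proof. exact: RintegralD. Qed.

Lemma ExB X Y : itg mu X -> itg mu Y ->
  Ex mu (fun w => X w - Y w) = Ex mu X - Ex mu Y.
Proof. exact: RintegralB. Qed.

Lemma ExZ c X : itg mu X -> Ex mu (fun w => c * X w) = c * Ex mu X.
Proof. exact: RintegralZl. Qed.

Lemma ExN X : itg mu X -> Ex mu (fun w => - X w) = - Ex mu X.
Proof.
move=> iX; rewrite -mulN1r -ExZ//; congr (Ex mu _).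
by apply/funext => w; rewrite mulN1r.
Qed.

Lemma Ex_cst c : Ex mu (fun=> c) = c.
Proof. by rewrite Rintegral_cst// probability_measure_setT mulr1. Qed.

Lemma Ex_indic A : measurable A -> Ex mu (\1_A) = fine (mu A).
Proof. by move=> mA; rewrite /Rintegral integral_indic// setIT. Qed.

Lemma le_Ex_norm X : itg mu X -> `|Ex mu X| <= Ex mu (fun w => `|X w|).
Proof. exact: le_normr_Rintegral. Qed.

Lemma EFin_Ex X : itg mu X -> (Ex mu X)%:E = (\int[mu]_w (X w)%:E)%E.
Proof. by move=> iX; rewrite fineK//; exact: integrable_fin_num. Qed.

Lemma EFin_expectation X : itg mu X -> ('E_mu[X] = (Ex mu X)%:E)%E.
Proof. by move=> iX; rewrite unlock -EFin_Ex. Qed.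

(** Tested on the set where X is negative, the hypothesis makes the integral of the
    nonnegative function -X 1_A vanish. *)
Lemma ae_ge0_of_Ex_indic X : itg mu X ->
  (forall A, measurable A -> 0 <= Ex mu (fun w => \1_A w * X w)) ->
  \forall w \ae mu, 0 <= X w.
Proof.
move=> iX X0; have mX := itg_measurable iX.
pose A := [set w | X w < 0].
have mA : measurable A.
  rewrite (_ : A = X @^-1` `]-oo, 0[); last first.
    by apply/seteqP; split => w /=; rewrite in_itv.
  by rewrite -[X in measurable X]setTI; exact: mX.
have iA := itg_indic mA iX.
have AX0 w : \1_A w * X w <= 0.
  rewrite indicE; have [wA|_] := boolP (w \in A); last by rewrite mul0r.
  by rewrite mul1r ltW//; exact: (set_mem wA).
have : ae_eq mu setT (fun w => (\1_A w * X w)%:E) (cst 0%E).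
  apply/ae_eq_integral_abs => //; first exact: measurable_int iA.
  transitivity (Ex mu (fun w => - (\1_A w * X w)))%:E.
    rewrite EFin_Ex; last exact: itgN.
    by apply: eq_integral => w _ /=; rewrite ler0_norm.
  congr EFin; apply/eqP; rewrite eq_le; apply/andP; split.
    by rewrite ExN// oppr_le0; exact: X0.
  by apply: Rintegral_ge0 => w _; rewrite oppr_ge0.
apply: filterS => w /(_ I) []; rewrite indicE.
have [wA|wA _] := boolP (w \in A).
  by rewrite mul1r => ->.
by rewrite leNgt; apply/negP => lt; move/negP: wA; apply; exact: mem_set.
Qed.

(** Dominated convergence: the excess over n decreases to 0 under |X|. *)
Lemma Ex_excess_small X e : itg mu X -> 0 < e ->
  exists2 M : R, 0 <= M & Ex mu (fun w => Num.max (`|X w| - M) 0) <= e.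
Proof.
move=> iX e0; have mX := itg_measurable iX.
have mf (n : nat) : measurable_fun setT (fun w => Num.max (`|X w| - n%:R) 0).
  apply: measurable_maxr => //; apply: measurable_funB => //.
  exact: measurableT_comp.
have : (\int[mu]_w (Num.max (`|X w| - n%:R) 0)%R%:E)%E @[n --> \oo] -->
       (\int[mu]_w (cst 0 w))%E.
  apply: (@dominated_cvg _ _ _ mu setT _ _ _ (fun w => `|X w|%:E)) => //.
  - by move=> n; exact/measurable_EFinP.
  - move=> w _; apply: cvg_near_cst; near=> n; congr EFin.
    apply/max_idPr; rewrite subr_le0.
    near: n; exact: nbhs_infty_ger.
  - exact: itg_norm.
  - move=> n w _ /=; rewrite lee_fin ger0_norm ?le_max ?lexx ?orbT//.
    by rewrite ge_max normr_ge0 andbT gerBl.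
rewrite integral0 => /fine_cvgP[_ /cvgrPdist_le/(_ _ e0)[n _ /(_ n (leqnn n))]].
rewrite /= sub0r normrN => le; exists n%:R => //.
by apply: le_trans le; exact: ler_norm.
Unshelve. all: by end_near. Qed.

End real_integrals.

Section Lfun_representatives.
Context {d : measure_display} {T : measurableType d} {R : realType}.
Variable P : probability T R.

(** Elements of Linf are functions whose essential supremum is finite, so that the
    bound can hold only almost everywhere. *)
Lemma Linf_bounded (xi : Linf P) :
  exists2 M : R, 0 <= M & \forall w \ae P, `|xi w| <= M.
Proof.
have := Lfunction_finite _ xi; rewrite /finite_norm unlock /Lnorm.
rewrite probability_measure_setT lte01 => h.
have [M hM] := @ess_supr_bounded _ _ _ P (fun w => `|xi w|) h.
exists (Num.max M 0); first by rewrite le_max lexx orbT.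
by apply: filterS hM => w /le_trans; apply; rewrite le_max lexx.
Qed.

Lemma bounded_Lfun (X : T -> R) M : measurable_fun setT X ->
  (\forall w \ae P, `|X w| <= M) -> X \in Lfun P +oo%E.
Proof.
move=> mX XM; rewrite inE; apply/andP; split; rewrite inE//=.
rewrite /finite_norm unlock /Lnorm probability_measure_setT lte01.
apply: (@le_lt_trans _ _ M%:E); last by rewrite ltry.
by apply/ess_supP; apply: filterS XM => w; rewrite lee_fin.
Qed.

Definition mkLinf (X : T -> R) M (mX : measurable_fun setT X)
    (XM : \forall w \ae P, `|X w| <= M) : Linf P :=
  Lfun_Sub (leey 1) (bounded_Lfun mX XM).

Lemma indic_bounded A : \forall w \ae P, `|\1_A w : R| <= 1.
Proof.
by apply: nearW => w; rewrite indicE; case: (w \in A); rewrite ?normr1 ?normr0.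
Qed.

Definition indic_Linf A (mA : measurable A) : Linf P :=
  mkLinf (measurable_indic mA) (indic_bounded A).

Definition mkL1 (X : T -> R) (iX : itg P X) : L1 P :=
  Lfun_Sub (lexx 1%E) ((Lfun1_integrable P X).2 iX).

Lemma L1_itg (eta : L1 P) : itg P eta.
Proof. by apply/Lfun1_integrable; exact: LfunP. Qed.

Lemma Linf_itgM (xi : Linf P) X : itg P X -> itg P (fun w => xi w * X w).
Proof. by have [M _ xiM] := Linf_bounded xi; exact: (itgM _ xiM). Qed.

End Lfun_representatives.

(** * Densities of absolutely continuous probabilities *)

Section density_measure.
Context {d : measure_display} {T : measurableType d} {R : realType}.
Variables (P : probability T R) (D : T -> R).
Hypotheses (D0 : forall w, 0 <= D w) (iD : itg P D) (D1 : Ex P D = 1).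

Let nu (A : set T) : \bar R := (\int[P]_(w in A) (D w)%:E)%E.

Let nu0 : nu set0 = 0%E. Proof. exact: integral_set0. Qed.

Let nu_ge0 A : (0 <= nu A)%E.
Proof. by apply: integral_ge0 => w _; rewrite lee_fin. Qed.

Let nu_sigma_additive : semi_sigma_additive nu.
Proof.
apply: semi_sigma_additive_nng_induced => [|w]; last by rewrite lee_fin.
exact: measurable_int iD.
Qed.

HB.instance Definition _ := isMeasure.Build _ _ _ nu
  nu0 nu_ge0 nu_sigma_additive.

Let nuT : nu setT = 1%E.
Proof. by rewrite /nu -EFin_Ex// D1. Qed.

HB.instance Definition _ := Measure_isProbability.Build _ _ _ nu nuT.

(** The measure with density D; D is assumed nonnegative everywhere so that its
    indefinite integral is a measure without modification. *)
Lemma density_probability : exists Q : acprob P,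
  forall A, measurable A -> Q A = (\int[P]_(w in A) (D w)%:E)%E.
Proof.
have nuP : nu `<< P.
  apply/null_content_dominatesP => A mA PA; apply: null_set_integral => //.
  by apply: measurable_funTS; exact: measurable_int iD.
by exists (exist (fun Q : probability T R => Q `<< P) nu nuP).
Qed.

End density_measure.

Section densities.
Context {d : measure_display} {T : measurableType d} {R : realType}.
Variable P : probability T R.
Implicit Types (Q : acprob P) (X D : T -> R).

Lemma acprob_ae Q (p : T -> Prop) :
  (\forall w \ae P, p w) -> \forall w \ae Q, p w.
Proof.
move=> [N [mN PN0 Np]]; exists N; split => //.
have /null_content_dominatesP := svalP Q; exact.
Qed.

Lemma EFin_dens Q w : (dens Q w)%:E = ('d (charge_of_finite_measure Q) '/d P) w.
Proof.
by rewrite /dens/= /dens_fun/= fineK// Radon_Nikodym_fin_num//; exact: (svalP Q).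
Qed.

Lemma dens_ge0 Q : \forall w \ae P, 0 <= dens Q w.
Proof.
have QP : Q `<< P := svalP Q.
apply: filterS (ae_eq_Radon_Nikodym_SigmaFinite QP measurableT) => w /(_ I) h.
rewrite -lee_fin EFin_dens -h.
exact: Radon_Nikodym_SigmaFinite.f_ge0.
Qed.

Lemma itg_dens Q X : itg Q X -> itg P (fun w => X w * dens Q w).
Proof.
move=> iX; have mX := itg_measurable iX.
apply/integrableP; split.
  apply/measurable_EFinP; apply: measurable_funM => //.
have [_] := integrableP _ _ _ (itg_norm iX).
apply: le_lt_trans.
have := @Radon_Nikodym_change_of_variables _ _ _ Q P (svalP Q) _ setT
  measurableT (itg_norm iX).
rewrite [X in _ -> (_ <= X)%E](_ : _ = \int[Q]_w `|X w|%:E)%E; last first.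
  by apply: eq_integral => w _ /=; rewrite normr_id.
move=> <-.
rewrite le_eqVlt; apply/orP; left; apply/eqP; apply: ae_eq_integral => //.
- apply/measurable_EFinP; apply: measurableT_comp => //; apply: measurable_funM => //.
- apply: (eq_measurable_fun (fun w => (`|X w| * dens Q w)%:E)).
    by move=> w _; rewrite -EFin_dens.
  apply/measurable_EFinP; apply: measurable_funM => //.
    exact: measurableT_comp.
apply: filterS (dens_ge0 Q) => w Q0 _ /=.
by rewrite -EFin_dens -EFinM normrM (ger0_norm Q0).
Qed.

Lemma Ex_dens Q X : itg Q X -> Ex Q X = Ex P (fun w => X w * dens Q w).
Proof.
move=> iX; congr fine.
rewrite -(@Radon_Nikodym_change_of_variables _ _ _ Q P (svalP Q))//.
by apply: eq_integral => w _; rewrite -EFin_dens.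
Qed.

Lemma dens_unique Q D : itg P D ->
  (forall A, measurable A -> Q A = (\int[P]_(w in A) (D w)%:E)%E) ->
  \forall w \ae P, dens Q w = D w.
Proof.
move=> iD QD.
have : ae_eq P setT (EFin \o dens Q) (EFin \o D).
  apply: integral_ae_eq => //.
  - exact: L1_itg.
  - exact: measurable_int iD.
  - move=> A _ mA; rewrite -QD//.
    have /= -> := Radon_Nikodym_integral (svalP Q : charge_of_finite_measure Q `<< P) mA.
    by apply: eq_integral => w _; rewrite -EFin_dens.
by apply: filterS => w /(_ I) [].
Qed.

Lemma exists_density D : (\forall w \ae P, 0 <= D w) -> itg P D ->
  Ex P D = 1 -> exists Q : acprob P, \forall w \ae P, dens Q w = D w.
Proof.
move=> D0 iD D1; pose D' w := Num.max (D w) 0.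
have mD := itg_measurable iD.
have mD' : measurable_fun setT D' by exact: measurable_maxr.
have DD' : \forall w \ae P, D' w = D w.
  by apply: filterS D0 => w Dw; exact/max_idPl.
have iD' : itg P D'.
  by apply: (itg_dominated mD' (itg_norm iD)); apply: filterS DD' => w ->.
have [|//||Q QD'] := @density_probability _ _ _ P D'.
- by move=> w; rewrite le_max lexx orbT.
- by rewrite -D1; exact: ae_eq_Ex.
exists Q; have QD := dens_unique iD' QD'.
by apply: filterS2 QD DD' => w -> ->.
Qed.

Lemma fine_acprobE Q A : measurable A ->
  fine (Q A) = Ex P (fun w => \1_A w * dens Q w).
Proof.
move=> mA; rewrite -Ex_dens; last exact: integrable_indic.
by rewrite Ex_indic.
Qed.

Lemma Ex_dens1 Q : Ex P (dens Q) = 1.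
Proof.
rewrite -[RHS](Ex_cst Q 1) (Ex_dens (itg_cst Q 1)).
by congr (Ex P _); apply/funext => w; rewrite mul1r.
Qed.

Lemma Ex_indic_norm_dens Q A : measurable A ->
  Ex P (fun w => \1_A w * `|dens Q w|) = fine (Q A).
Proof.
move=> mA; rewrite fine_acprobE//; apply: ae_eq_Ex.
- exact: itg_measurable (itg_indic mA (itg_norm (L1_itg (dens Q)))).
- exact: itg_measurable (itg_indic mA (L1_itg (dens Q))).
- by apply: filterS (dens_ge0 Q) => w h; rewrite ger0_norm.
Qed.

(** The convex combination of two measures is rebuilt from the combination of the
    densities, which gives at once its values on sets and the affinity of the
    expectation in the measure. *)
Lemma exists_convex_combination (Q1 Q2 : acprob P) (t : R) : 0 <= t <= 1 ->
  exists Q : acprob P,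
    [/\ forall A, measurable A -> Q A = (t%:E * Q1 A + (1 - t)%:E * Q2 A)%E,
        \forall w \ae P, dens Q w = t * dens Q1 w + (1 - t) * dens Q2 w &
        forall X, itg Q1 X -> itg Q2 X -> itg Q X ->
          Ex Q X = t * Ex Q1 X + (1 - t) * Ex Q2 X].
Proof.
move=> /andP[t0 t1]; have t1' : 0 <= 1 - t by rewrite subr_ge0.
have i1 := L1_itg (dens Q1); have i2 := L1_itg (dens Q2).
have [|||Q QD] := @exists_density (fun w => t * dens Q1 w + (1 - t) * dens Q2 w).
- apply: filterS2 (dens_ge0 Q1) (dens_ge0 Q2) => w h1 h2.
  by rewrite addr_ge0// mulr_ge0.
- by apply: itgD; exact: itgZ.
- by rewrite ExD ?ExZ ?Ex_dens1//; [lra|exact: itgZ|exact: itgZ].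
have comb X : itg Q1 X -> itg Q2 X -> itg Q X ->
    Ex Q X = t * Ex Q1 X + (1 - t) * Ex Q2 X.
  move=> iX1 iX2 iX; rewrite !Ex_dens// -!ExZ ?itg_dens// -ExD; last 2 first.
  - by apply: itgZ; exact: itg_dens.
  - by apply: itgZ; exact: itg_dens.
  have iD1 := itg_dens iX1; have iD2 := itg_dens iX2.
  apply: ae_eq_Ex.
  - exact: itg_measurable (itg_dens iX).
  - by apply: (@itg_measurable _ _ _ P); apply: itgD; exact: itgZ.
  - by apply: filterS QD => w ->; ring.
exists Q; split => // A mA.
have iA Q' : itg Q' (\1_A : T -> R) by exact: integrable_indic.
have := comb (\1_A) (iA Q1) (iA Q2) (iA Q); rewrite !Ex_indic// => QA.
have E (Q' : acprob P) : Q' A = (fine (Q' A))%:E by rewrite fineK// fin_num_measure.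
by rewrite (E Q) (E Q1) (E Q2) QA EFinD !EFinM.
Qed.

End densities.

(** * Weak compactness in L1 along an ultrafilter *)

Section ultrafilter_limits.
Context {R : realType} {Z : Type}.
Variable U : set_system Z.
Hypothesis UU : UltraFilter U.

(** A cluster point in the compact interval is a limit, since an ultrafilter
    contains either a given neighbourhood or its complement. *)
Lemma ultra_bounded_cvg (r : Z -> R) (M : R) : (\forall z \near U, `|r z| <= M) ->
  exists l : R, r z @[z --> U] --> l.
Proof.
move=> rM; have rU : fmap r U [set` `[- M, M]].
  by apply: filterS rM => z; rewrite /= in_itv/= -ler_norml.
have [p [_ clp]] := segment_compact _ rU.
exists p; apply/cvgrPdist_lt => e e0.
have [//|nU] := in_ultra_setVsetC [set z | `|p - r z| < e] UU.
have rnU : fmap r U [set y : R | ~ `|p - y| < e] by exact: nU.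
by have [y [/= ny py]] := clp _ _ rnU (nbhsx_ballx (p : R^o) e e0).
Qed.

Lemma cvg_near_le (r s : Z -> R) (a b : R) : r z @[z --> U] --> a ->
  s z @[z --> U] --> b -> (\forall z \near U, r z <= s z) -> a <= b.
Proof.
move=> ra sb rs; apply/ler_addgt0Pr => e e0.
have e2 : 0 < e / 2 by rewrite divr_gt0.
have [z [[z1 z2] z3]] : exists z,
    (`|a - r z| < e / 2 /\ `|b - s z| < e / 2) /\ r z <= s z.
  apply: (@filter_ex _ U); apply: filterI rs; apply: filterI.
  - by move/cvgrPdist_lt : ra; exact.
  - by move/cvgrPdist_lt : sb; exact.
by move: z1 z2; rewrite !ltr_norml => /andP[? ?] /andP[? ?]; lra.
Qed.

End ultrafilter_limits.

Section dunford_pettis.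
Context {d : measure_display} {T : measurableType d} {R : realType}.
Variables (P : probability T R) (Z : Type) (U : set_system Z).
Hypothesis UU : UltraFilter U.
Variables (e : Z -> L1 P) (M : R).
Hypothesis eM : \forall z \near U, Ex P (fun w => `|e z w|) <= M.
Hypothesis e_tail : forall A : (set T)^nat, (forall n, measurable (A n)) ->
  (forall n, A n.+1 `<=` A n) -> \bigcap_n A n = set0 ->
  forall eps : R, 0 < eps -> exists n, \forall z \near U,
    Ex P (fun w => \1_(A n) w * `|e z w|) <= eps.

Let r (A : set T) (z : Z) : R := Ex P (fun w => \1_A w * e z w).

Let ie z : itg P (e z). Proof. exact: L1_itg. Qed.

Let r_norm A z : measurable A -> `|r A z| <= Ex P (fun w => \1_A w * `|e z w|).
Proof.
move=> mA; apply: le_trans (le_Ex_norm _) _; first exact: itg_indic.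
apply: ae_le_Ex.
- by apply: itg_norm; exact: itg_indic.
- by apply: itg_indic => //; exact: itg_norm.
- by apply: nearW => w; rewrite normrM [`|\1_A w|]ger0_norm.
Qed.

Let r_le A B z : measurable A -> measurable B -> A `<=` B ->
  Ex P (fun w => \1_A w * `|e z w|) <= Ex P (fun w => \1_B w * `|e z w|).
Proof.
move=> mA mB AB; apply: ae_le_Ex.
- by apply: itg_indic => //; exact: itg_norm.
- by apply: itg_indic => //; exact: itg_norm.
- apply: nearW => w; rewrite ler_wpM2r// !indicE.
  have [wA|//] := boolP (w \in A).
  by rewrite (_ : w \in B)//; apply/mem_set/AB/set_mem.
Qed.

Let rM A : measurable A -> \forall z \near U, `|r A z| <= M.
Proof.
move=> mA; apply: filterS eM => z; apply: le_trans.
apply: le_trans (r_norm z mA) _; apply: le_trans (r_le z mA measurableT _) _ => //.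
by rewrite le_eqVlt (_ : (fun w => _) = (fun w => `|e z w|)) ?eqxx//;
  apply/funext => w; rewrite indicT mul1r.
Qed.

Let l (A : set T) : R := lim (r A z @[z --> U]).

Let r_cvg A : measurable A -> r A z @[z --> U] --> l A.
Proof.
move=> mA; have [y rA] := ultra_bounded_cvg UU (rM mA).
by rewrite /l (cvg_lim _ rA).
Qed.

Let l_unique A y : r A z @[z --> U] --> y -> l A = y.
Proof. by move=> rA; exact: cvg_lim. Qed.

Let nu (A : set T) : \bar R := (l A)%:E.

Let nu0 : nu set0 = 0%E.
Proof.
rewrite /nu (@l_unique _ 0)//; apply: cvg_near_cst; apply: nearW => z.
rewrite /r (_ : (fun w => _) = (fun=> 0)) ?Ex_cst//.
by apply/funext => w; rewrite indic0 mul0r.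
Qed.

Let nu_fin A : measurable A -> nu A \is a fin_num. Proof. by []. Qed.

Let lD A B : measurable A -> measurable B -> A `&` B = set0 ->
  l (A `|` B) = l A + l B.
Proof.
move=> mA mB AB; apply: l_unique.
rewrite (_ : r (A `|` B) = (fun z => r A z + r B z)).
  by apply: cvgD; exact: r_cvg.
apply/funext => z; rewrite /r -ExD; [|exact: itg_indic|exact: itg_indic].
congr (Ex P _); apply/funext => w; rewrite -mulrDl; congr (_ * _).
rewrite !indicE in_setU; case: (boolP (w \in A)) => wA; case: (boolP (w \in B)) => wB;
  rewrite ?addr0 ?add0r//.
by have : set0 w by rewrite -AB; split; exact: set_mem.
Qed.

Let l_small A eps : measurable A ->
  (\forall z \near U, Ex P (fun w => \1_A w * `|e z w|) <= eps) -> `|l A| <= eps.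
Proof.
move=> mA small; have := r_cvg mA.
move=> /cvg_norm h; apply: cvg_near_le h (cvg_cst eps) _.
by apply: filterS small => z; apply: le_trans; exact: r_norm.
Qed.

Let nu_sigma_additive : semi_sigma_additive nu.
Proof.
move=> F mF tF mUF.
pose B n := \bigcup_(i in [set i | (n <= i)%N]) F i.
have mB n : measurable (B n) by apply: bigcup_measurable => i _; exact: mF.
have BS n : B n = F n `|` B n.+1.
  apply/seteqP; split => [w [i /= ni Fi]|w [Fw|[i /= ni Fi]]].
  - move: ni; rewrite leq_eqVlt => /predU1P[->|ni]; [by left|by right; exists i].
  - by exists n => //=.
  - by exists i => //=; exact: ltnW.
have FB n : F n `&` B n.+1 = set0.
  apply/seteqP; split => // w [Fw [i /= ni Fi]].
  have nE := tF n i I I (ex_intro _ w (conj Fw Fi)).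
  by move: ni; rewrite nE ltnn.
have sumE n : l (\bigcup_i F i) = \sum_(0 <= i < n) l (F i) + l (B n).
  elim: n => [|n ih].
    rewrite big_geq// add0r; congr l; apply/seteqP; split => w [i _ Fi];
    by exists i.
  rewrite ih big_nat_recr//= -addrA; congr (_ + _).
  by rewrite BS lD.
rewrite /nu; under eq_fun do rewrite sumEFin.
apply/fine_cvgP; split; first exact: nearW.
apply/cvgrPdist_le => /= eps eps0.
have [||n small] := e_tail mB _ _ eps0.
- by move=> n w [i /= ni Fi]; exists i => //=; exact: ltnW.
- apply/seteqP; split => // w /= Bw.
  have [i _ Fi] := Bw 0%N I; have [j /= ij Fj] := Bw i.+1 I.
  have nE := tF i j I I (ex_intro _ w (conj Fi Fj)).
  by move: ij; rewrite nE ltnn.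
exists n => // m /= nm.
rewrite (sumE m) addrAC subrr add0r; apply: l_small => //.
apply: filterS small => z; apply: le_trans; apply: r_le => //.
by move=> w [i /= mi Fi]; exists i => //=; exact: leq_trans mi.
Qed.

HB.instance Definition _ := isCharge.Build _ _ _ nu nu0 nu_fin nu_sigma_additive.

Let nuP : nu `<< P.
Proof.
apply/null_content_dominatesP => A mA PA; rewrite /nu (@l_unique _ 0)//.
apply: cvg_near_cst; apply: nearW => z; rewrite /r.
rewrite (@ae_eq_Ex _ _ _ _ _ (fun=> 0)) ?Ex_cst//.
- exact: itg_measurable (itg_indic mA (ie z)).
- exists A; split => // w /= nAw; apply: contrapT => Aw; apply: nAw.
  by rewrite indicE memNset// mul0r.
Qed.

Let limit_density : exists eta : L1 P,
  forall A, measurable A -> Ex P (fun w => \1_A w * eta w) = l A.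
Proof.
pose D := fine \o ('d nu '/d P).
have DE : EFin \o D = 'd nu '/d P.
  by apply/funext => w; rewrite /= fineK// Radon_Nikodym_fin_num.
have iD : itg P D by rewrite DE; exact: Radon_Nikodym_integrable.
exists (mkL1 iD) => A mA; apply: EFin_inj; rewrite EFin_Ex; last exact: itg_indic.
rewrite -[RHS]/(nu A) (Radon_Nikodym_integral nuP mA) [RHS]integral_mkcond.
apply: eq_integral => w _; rewrite patchE indicE -DE /=.
by case: (w \in A); rewrite ?mul1r ?mul0r.
Qed.

(** The limits of E[e 1_A] along the ultrafilter form a finitely additive set
    function; the uniform smallness on sets decreasing to the empty set makes it
    countably additive, and the Radon-Nikodym theorem turns it into an element of
    L1.  Convergence on indicators extends to bounded functions by splitting off
    binary digits. *)
Lemma dunford_pettis : exists eta : L1 P, forall xi : Linf P,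
  Ex P (fun w => xi w * e z w) @[z --> U] --> Ex P (fun w => xi w * eta w).
Proof.
have [eta etaE] := limit_density; exists eta => xi.
have ieta := L1_itg eta.
pose N := M + Ex P (fun w => `|eta w|).
have bound (X : T -> R) (K : R) (Y : T -> R) :
    itg P Y -> measurable_fun setT X -> 0 <= K ->
    (forall w, 0 <= X w <= K) ->
    `|Ex P (fun w => X w * Y w)| <= K * Ex P (fun w => `|Y w|).
  move=> iY mX K0 XK.
  have aeX : \forall w \ae P, `|X w| <= K.
    by apply: nearW => w; case/andP: (XK w) => X0 XK'; rewrite ger0_norm.
  have iXY : itg P (fun w => X w * Y w) by exact: (itgM mX aeX).
  apply: le_trans (le_Ex_norm iXY) _; rewrite -ExZ; last exact: itg_norm.
  apply: ae_le_Ex; [exact: itg_norm|by apply: itgZ; exact: itg_norm|].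
  by apply: filterS aeX => w Xw; rewrite normrM ler_wpM2r.
(* each step splits off the top binary digit of [X], which is a multiple of an
   indicator function, and halves the remaining error *)
have approx j : forall (K : R) (X : T -> R), 0 <= K -> measurable_fun setT X ->
    (forall w, 0 <= X w <= K) -> forall eps : R, 0 < eps -> \forall z \near U,
    `|Ex P (fun w => X w * e z w) - Ex P (fun w => X w * eta w)|
      <= K / 2 ^+ j * N + eps.
  elim: j => [|j ih] K X K0 mX XK eps eps0.
    apply: filterS eM => z ezM; rewrite expr0 divr1.
    apply: le_trans (ler_normB _ _) _.
    have h1 := bound X K (e z) (ie z) mX K0 XK.
    have h2 := bound X K eta ieta mX K0 XK.
    by have := ler_wpM2l K0 ezM; rewrite /N mulrDr; lra.
  pose B := [set w | K / 2 <= X w].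
  have mB : measurable B.
    rewrite (_ : B = X @^-1` `[K / 2, +oo[); last first.
      by apply/seteqP; split => w /=; rewrite in_itv/= andbT.
    by rewrite -[X in measurable X]setTI; exact: mX.
  pose X' w : R := X w - K / 2 * \1_B w.
  have mX' : measurable_fun setT X'.
    by apply: measurable_funB => //; exact: measurable_funM.
  have X'K w : 0 <= X' w <= K / 2.
    have /andP[X0 XK'] := XK w; rewrite /X' indicE.
    have [wB|wB] := boolP (w \in B).
      have h : K / 2 <= X w := set_mem wB.
      by rewrite /= mulr1; apply/andP; split; lra.
    rewrite mulr0 subr0 X0/=; apply/ltW; rewrite ltNge; apply/negP => h.
    by move/negP: wB; apply; exact: mem_set.
  have XE (Y : T -> R) : itg P Y -> Ex P (fun w => X w * Y w) =
      Ex P (fun w => X' w * Y w) + K / 2 * Ex P (fun w => \1_B w * Y w).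
    move=> iY; have iB := itg_indic mB iY.
    have iX' : itg P (fun w => X' w * Y w).
      apply: (@itgM _ _ _ _ X' _ (K / 2)) => //; apply: nearW => w.
      by have /andP[? ?] := X'K w; rewrite ger0_norm.
    rewrite -ExZ// -ExD//; last exact: itgZ.
    by congr (Ex P _); apply/funext => w; rewrite /X'; ring.
  have K2 : 0 <= K / 2 by rewrite divr_ge0.
  have eps2 : 0 < eps / 2 by rewrite divr_gt0.
  have h1 := ih _ _ K2 mX' X'K _ eps2.
  have eps3 : 0 < eps / (K + 1) by rewrite divr_gt0//; lra.
  have := r_cvg mB => /cvgrPdist_le/(_ _ eps3).
  apply: filterS2 h1 => z h1 h2; rewrite !XE// (etaE B)//.
  rewrite [X in `|X|](_ : _ =
    (Ex P (fun w => X' w * e z w) - Ex P (fun w => X' w * eta w)) -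
    K / 2 * (l B - r B z)); last by rewrite /r; ring.
  apply: le_trans (ler_normB _ _) _.
  have h3 : `|K / 2 * (l B - r B z)| <= eps / 2.
    rewrite normrM ger0_norm//.
    apply: le_trans (ler_wpM2l K2 h2) _.
    rewrite mulrA ler_pdivrMr; last by lra.
    by nra.
  have hE : K / 2 ^+ j.+1 = K / 2 / 2 ^+ j by rewrite exprS invfM mulrA.
  by rewrite hE; lra.
have cvg_pos : forall (K : R) (X : T -> R), 0 <= K -> measurable_fun setT X ->
    (forall w, 0 <= X w <= K) ->
    Ex P (fun w => X w * e z w) @[z --> U] --> Ex P (fun w => X w * eta w).
  move=> K X K0 mX XK; apply/cvgrPdist_le => eps eps0.
  have eps2 : 0 < eps / 2 by rewrite divr_gt0.
  have : (fun j => K / 2 ^+ j * N) @ \oo --> 0.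
    rewrite -(mul0r N); apply: cvgMr_tmp; rewrite -(mulr0 K); apply: cvgMl_tmp.
    under eq_fun do rewrite -exprVn.
    by apply: cvg_expr; rewrite ger0_norm// invf_lt1// ltr1n.
  move=> /cvgrPdist_le/(_ _ eps2)[j _ /(_ j (leqnn j))]/=.
  rewrite sub0r normrN => h; have h' := le_trans (ler_norm _) h.
  have := approx j K X K0 mX XK _ eps2.
  by apply: filterS => z; rewrite distrC; lra.
have [B B0 xiB] := Linf_bounded xi.
pose X w : R := Num.max (- B) (Num.min (xi w) B) + B.
have mX : measurable_fun setT X.
  by apply: measurable_funD => //; apply: measurable_maxr => //; exact: measurable_minr.
have XK w : 0 <= X w <= 2 * B.
  rewrite /X; apply/andP; split.
    by rewrite -lerBlDr sub0r le_max lexx.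
  have : Num.max (- B) (Num.min (xi w) B) <= B.
    by rewrite ge_max ge_min lexx orbT andbT; lra.
  by lra.
have xiX : \forall w \ae P, xi w = X w - B.
  apply: filterS xiB => w; rewrite /X addrK ler_norml => /andP[h1 h2].
  by rewrite (min_idPl h2) (max_idPr h1).
have E (Y : T -> R) : itg P Y -> Ex P (fun w => xi w * Y w) =
    Ex P (fun w => X w * Y w) - B * Ex P (fun w => \1_setT w * Y w).
  move=> iY; have iXY : itg P (fun w => X w * Y w).
    apply: (@itgM _ _ _ _ X _ (2 * B)) => //; apply: nearW => w.
    by have /andP[? ?] := XK w; rewrite ger0_norm.
  have i1 := itg_indic measurableT iY.
  rewrite -ExZ// -ExB//; last exact: itgZ.
  apply: ae_eq_Ex.
  - exact: itg_measurable (Linf_itgM xi iY).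
  - by apply: (@itg_measurable _ _ _ P); apply: itgB => //; exact: itgZ.
  - by apply: filterS xiX => w ->; rewrite indicT /=; ring.
rewrite (E _ ieta) (_ : (fun z => _) =
    (fun z => Ex P (fun w => X w * e z w) - B * r setT z)); last first.
  by apply/funext => z; rewrite E.
apply: cvgB; first by apply: (cvg_pos (2 * B)) => //; lra.
by apply: cvgMl_tmp; rewrite etaE//; exact: r_cvg.
Qed.

End dunford_pettis.

(** * Sublevel sets of the penalty *)

Section weak_topology_on_probabilities.
Context {d : measure_display} {T : measurableType d} {R : realType}.
Variable P : probability T R.

Lemma initial_cvg (S : choiceType) (V : topologicalType) (f : S -> V)
    (F : set_system S) (s : S) :
  Filter F -> f x @[x --> F] --> f s -> F --> (s : initial_topology f).
Proof.
move=> FF fs A /= [_ [[B oB <-] Bs sBA]].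
exact: (@filterS _ F FF _ _ sBA (fs B (open_nbhs_nbhs (conj oB Bs)))).
Qed.

Lemma fine_expectation_dens (xi : Linf P) (Q : acprob P) :
  pairing (dens Q) xi = Ex P (fun w => xi w * dens Q w).
Proof. by rewrite /pairing unlock. Qed.

(** The topology of [wacprob] is the initial topology of the pairings with Linf, so
    testing on each of them is enough. *)
Lemma cvg_wacprob (F : set_system (acprob P)) (Q : acprob P) : Filter F ->
  (forall xi : Linf P, Ex P (fun w => xi w * dens q w) @[q --> F] -->
    Ex P (fun w => xi w * dens Q w)) -> F --> (Q : wacprob P).
Proof.
move=> FF h; apply: initial_cvg.
apply: (@initial_cvg _ _ (@pairing _ _ _ P)).
apply/cvg_sup => xi; apply: (@initial_cvg _ R (fun f : {ptws Linf P -> R} => f xi)).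
have : pairing (dens q) xi @[q --> F] --> pairing (dens Q) xi.
  rewrite fine_expectation_dens; under eq_fun do rewrite fine_expectation_dens.
  exact: h.
exact.
Qed.

Lemma wacprob_continuous (xi : Linf P) :
  continuous (fun Q : wacprob P => Ex P (fun w => xi w * dens (Q : acprob P) w)).
Proof.
rewrite [X in continuous X](_ : _ = fun Q : wacprob P => pairing (dens Q) xi).
  move=> Q.
  apply: (@continuous_comp (wacprob P) (weakL1 P) R
    (fun Q : acprob P => dens Q : weakL1 P) (fun eta => pairing eta xi)).
    exact: (@initial_continuous _ (weakL1 P) (fun Q : acprob P => dens Q : weakL1 P)).
  apply: (@continuous_comp (weakL1 P) {ptws Linf P -> R} R
    (@pairing _ _ _ P) (fun f => f xi)).
    exact: (@initial_continuous _ {ptws Linf P -> R} (@pairing _ _ _ P)).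
  exact: (@proj_continuous _ (fun=> R)).
by apply/funext => Q; rewrite /= fine_expectation_dens.
Qed.

End weak_topology_on_probabilities.

Section penalty.
Context {d : measure_display} {T : measurableType d} {R : realType}.
Variables (P : probability T R) (gamma : acprob P -> \bar R).
Hypothesis gamma_penalty : penalty gamma.

Definition gam (Q : acprob P) : R := fine (gamma Q).

Lemma gam_ge0 Q : 0 <= gam Q.
Proof. by apply: fine_ge0; exact: penalty_ge0. Qed.

Lemma gamE Q : Qgamma gamma Q -> gamma Q = (gam Q)%:E.
Proof.
move=> Qg; rewrite fineK// ge0_fin_numE//; exact: penalty_ge0.
Qed.

Lemma Qgamma_le Q (c : R) : (gamma Q <= c%:E)%E -> Qgamma gamma Q /\ gam Q <= c.
Proof.
move=> Qc; have Qg : Qgamma gamma Q by apply: le_lt_trans Qc _; rewrite ltry.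
by split => //; rewrite -lee_fin -gamE.
Qed.

(** The hypothesis of convexity speaks of measures that are combinations of others;
    such measures exist. *)
Lemma penalty_convex_combination (Q1 Q2 : acprob P) (t : R) : 0 <= t <= 1 ->
  Qgamma gamma Q1 -> Qgamma gamma Q2 ->
  exists Q : acprob P,
    [/\ Qgamma gamma Q, gam Q <= t * gam Q1 + (1 - t) * gam Q2,
        forall A, measurable A ->
          Q A = (t%:E * Q1 A + (1 - t)%:E * Q2 A)%E &
        forall X, itg Q1 X -> itg Q2 X -> itg Q X ->
          Ex Q X = t * Ex Q1 X + (1 - t) * Ex Q2 X].
Proof.
move=> t01 g1 g2; have [Q [QE _ Qexp]] := exists_convex_combination Q1 Q2 t01.
have := penalty_convex gamma_penalty t01 QE.
rewrite (gamE g1) (gamE g2) -!EFinM -EFinD => /Qgamma_le[Qg le].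
by exists Q.
Qed.

(** Dini's argument: if Q_n(A_n) > eps for all n, then Q(A_m) stays
    above eps / 2 at a cluster point Q of the Q_n, against continuity from above. *)
Lemma penalty_le1_tail (A : (set T)^nat) (eps : R) :
  (forall n, measurable (A n)) -> (forall n, A n.+1 `<=` A n) ->
  \bigcap_n A n = set0 -> 0 < eps ->
  exists n, forall Q : acprob P, (gamma Q <= 1)%E -> fine (Q (A n)) <= eps.
Proof.
move=> mA dA A0 eps0; apply: contrapT => none.
have dA' m n : (m <= n)%N -> A n `<=` A m.
  elim: n => [|n ih]; first by rewrite leqn0 => /eqP ->.
  rewrite leq_eqVlt => /predU1P[->//|]; rewrite ltnS => /ih.
  by apply: subset_trans; exact: dA.
have /choice[q qP] : forall n, exists Q : acprob P,
    (gamma Q <= 1)%E /\ eps < fine (Q (A n)).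
  move=> n; apply: contrapT => nq; apply: none; exists n => Q Q1.
  by rewrite leNgt; apply/negP => lt; apply: nq; exists Q.
pose F : set_system (wacprob P) := (q n : wacprob P) @[n --> \oo].
have FA : F [set Q : wacprob P | (gamma Q <= 1)%E].
  by exists 0%N => // n _; exact: (qP n).1.
have [Q [Q1 clQ]] := penalty_compact gamma_penalty (fmap_proper_filter q _) FA.
have QA m : eps / 2 < fine ((Q : acprob P) (A m)).
  pose xi := indic_Linf P (mA m).
  have xiE (q' : acprob P) : Ex P (fun w => xi w * dens q' w) = fine (q' (A m)).
    by rewrite fine_acprobE.
  have eps2 : 0 < eps / 2 by rewrite divr_gt0.
  have /cvgrPdist_lt/(_ _ eps2) nQ := @wacprob_continuous _ _ _ P xi Q.
  have qm : ((q n : wacprob P) @[n --> \oo])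
      [set q' : wacprob P | eps < fine ((q' : acprob P) (A m))].
    exists m => // n /= mn; apply: lt_le_trans (qP n).2 _.
    apply: fine_le; rewrite ?fin_num_measure//.
    by apply: le_measure; rewrite ?inE//; exact: dA'.
  have [q' [/= q'm]] := clQ _ _ qm nQ.
  by rewrite !xiE ltr_norml => /andP[+ _]; lra.
have mcap : measurable (\bigcap_n A n) by rewrite A0.
have fin0 : ((Q : acprob P) (A 0%N) < +oo)%E by rewrite ltey_eq fin_num_measure.
have ndA : nonincreasing_seq A.
  by apply/nonincreasing_seqP => n; apply/subsetPset; exact: dA.
have := @nonincreasing_cvg_mu _ _ _ (Q : acprob P) A fin0 mA mcap ndA.
have eps2 : 0 < eps / 2 by rewrite divr_gt0.
rewrite A0 measure0 => /fine_cvgP[_ /cvgrPdist_lt/(_ _ eps2)[m _ /(_ m (leqnn m))]].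
rewrite /= sub0r normrN => lt; have := QA m.
by move: lt; rewrite ger0_norm ?fine_ge0//; lra.
Qed.

Lemma penalty_near0 : exists2 Q : acprob P, Qgamma gamma Q & gam Q <= 2^-1.
Proof.
have half0 : 0 < 2^-1 :> R by rewrite invr_gt0.
have inf0 := penalty_inf gamma_penalty.
have [|_ [Q _ <-] lt] :=
    lb_ereal_inf_adherent (S := [set gamma Q | Q in [set: acprob P]]) half0.
  by rewrite inf0.
rewrite inf0 add0e in lt.
by have [? ?] := Qgamma_le (ltW lt); exists Q.
Qed.

(** Mixing with a measure of penalty at most 1/2, with a small weight t on Q, sends
    the sublevel set at level c into {gamma <= 1} and loses only the factor t on
    the measure of sets. *)
Lemma penalty_sublevel_tail (c : R) (A : (set T)^nat) (eps : R) :
  (forall n, measurable (A n)) -> (forall n, A n.+1 `<=` A n) ->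
  \bigcap_n A n = set0 -> 0 < eps ->
  exists n, forall Q : acprob P, (gamma Q <= c%:E)%E -> fine (Q (A n)) <= eps.
Proof.
move=> mA dA A0 eps0; have [Q' gQ' Q'2] := penalty_near0.
pose t : R := (2 * (`|c| + 1))^-1.
have c1 : 1 <= `|c| + 1 by rewrite lerDr.
have t0 : 0 < t by rewrite invr_gt0 mulr_gt0//; lra.
have tE : t * (2 * (`|c| + 1)) = 1 by rewrite mulVf//; apply: lt0r_neq0; nra.
have t1 : t <= 1 by nra.
have [|n nP] := penalty_le1_tail mA dA A0 (eps := t * eps); first exact: mulr_gt0.
exists n => Q /Qgamma_le[gQ Qc].
have [|Q2 [gQ2 Q2le Q2E _]] := penalty_convex_combination (t := t) _ gQ gQ'.
  by rewrite ltW.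
have Q2_1 : (gamma Q2 <= 1)%E.
  rewrite (gamE gQ2) lee_fin; apply: le_trans Q2le _.
  have := ler_norm c; have := gam_ge0 Q; have := gam_ge0 Q'; nra.
have := nP Q2 Q2_1; rewrite Q2E//.
have E (q : acprob P) : q (A n) = (fine (q (A n)))%:E by rewrite fineK// fin_num_measure.
rewrite (E Q) (E Q') -!EFinM -EFinD /= => le.
have h : 0 <= fine (Q' (A n)) by rewrite fine_ge0.
rewrite -(ler_pM2l t0); nra.
Qed.

(** The sublevel set at level c is handled directly by [dunford_pettis] applied to
    the densities; lower semicontinuity keeps the limit in it. *)
Lemma penalty_ultralimit (Z : Type) (U : set_system Z) (q : Z -> acprob P) (c : R) :
  UltraFilter U -> (\forall z \near U, (gamma (q z) <= c%:E)%E) ->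
  exists Q : acprob P,
    [/\ Qgamma gamma Q,
        forall xi : Linf P, Ex P (fun w => xi w * dens (q z) w) @[z --> U] -->
          Ex P (fun w => xi w * dens Q w) &
        forall a, a < gam Q -> \forall z \near U, a < gam (q z)].
Proof.
move=> UU qc.
have [|A mA dA A0 eps eps0|D Dcvg] :=
    @dunford_pettis _ _ _ P Z U UU (fun z => dens (q z)) 1.
- apply: nearW => z; have E := Ex_indic_norm_dens (q z) measurableT.
  rewrite probability_setT /= in E.
  rewrite -[leRHS]E le_eqVlt; apply/orP; left; apply/eqP.
  by congr (Ex P _); apply/funext => w; rewrite indicT mul1r.
- have [n nP] := penalty_sublevel_tail c mA dA A0 eps0.
  exists n; apply: filterS qc => z /nP.
  by rewrite Ex_indic_norm_dens.
have iD := L1_itg D.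
have [||Q QD] := @exists_density _ _ _ P D _ iD.
- apply: ae_ge0_of_Ex_indic => // A mA.
  apply: cvg_near_le (cvg_cst 0) (Dcvg (indic_Linf P mA)) _.
  by apply: nearW => z; rewrite /= -fine_acprobE// fine_ge0.
- have DT (X : T -> R) : Ex P (fun w => \1_[set: T] w * X w) = Ex P X.
    by congr (Ex P _); apply/funext => w; rewrite indicT mul1r.
  have := Dcvg (indic_Linf P measurableT); rewrite /= DT => D1.
  rewrite -(cvg_lim (@Rhausdorff R) D1); apply: cvg_lim => //.
  by apply: cvg_near_cst; apply: nearW => z; rewrite DT Ex_dens1.
have Qcvg (xi : Linf P) : Ex P (fun w => xi w * dens (q z) w) @[z --> U] -->
    Ex P (fun w => xi w * dens Q w).
  rewrite (@ae_eq_Ex _ _ _ P (fun w => xi w * dens Q w) (fun w => xi w * D w)).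
  - exact: Dcvg.
  - exact: itg_measurable (Linf_itgM xi (L1_itg (dens Q))).
  - exact: itg_measurable (Linf_itgM xi iD).
  - by apply: filterS QD => w ->.
have qQ : q @ U --> (Q : wacprob P) by apply: cvg_wacprob => xi; exact: Qcvg.
have lsc a : (a%:E < gamma Q)%E -> \forall z \near U, (a%:E < gamma (q z))%E.
  move=> /(penalty_lsc gamma_penalty)[V nV VP].
  exact: (@filterS _ U _ _ _ (fun z => VP (q z)) (qQ V nV)).
have [Qg _] : Qgamma gamma Q /\ gam Q <= c.
  apply: Qgamma_le; rewrite leNgt; apply/negP => /lsc cq.
  have [z [/= h1 h2]] := @filter_ex _ U _ _ (filterI cq qc).
  by move: h1; rewrite ltNge h2.
exists Q; split => // a; rewrite -lte_fin -gamE// => /lsc aq.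
apply: filterS2 aq qc => z + /Qgamma_le[qg _].
by rewrite gamE.
Qed.

End penalty.

(** * Families with uniformly small excess *)

Section excess_control.
Context {d : measure_display} {T : measurableType d} {R : realType}.
Variables (P : probability T R) (gamma : acprob P -> \bar R).
Hypothesis gamma_penalty : penalty gamma.

(** What membership in M^rho_u yields for each single Q: the condition
    rho(al G 1_{G > N}) <= 1 unfolded as a supremum over Q, with the truncation
    replaced by the excess (G - N)^+, which is better behaved under maxima. *)
Definition excess_controlled (G : T -> R) := forall al : R, 0 < al ->
  exists2 N : R, 0 <= N & forall Q : acprob P, Qgamma gamma Q ->
    itg Q G /\ al * Ex Q (fun w => Num.max (G w - N) 0) <= 1 + gam gamma Q.

Lemma excess_controlled_itg G Q : excess_controlled G -> Qgamma gamma Q -> itg Q G.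
Proof. by move=> GE gQ; have [N _ /(_ Q gQ)[]] := GE 1 ltr01. Qed.

Lemma itg_max0 (mu : probability T R) (X : T -> R) : itg mu X ->
  itg mu (fun w => Num.max (X w) 0).
Proof.
move=> iX; have mX := itg_measurable iX; apply: (itg_dominated _ (itg_norm iX)).
  exact: measurable_maxr.
apply: nearW => w; rewrite ger0_norm ?le_max ?lexx ?orbT//.
by rewrite ge_max ler_norm normr_ge0.
Qed.

Lemma itg_excess (mu : probability T R) (X : T -> R) N : itg mu X ->
  itg mu (fun w => Num.max (X w - N) 0).
Proof. by move=> iX; apply: itg_max0; apply: itgB => //; exact: itg_cst. Qed.

Lemma excess_controlled_max G1 G2 : excess_controlled G1 -> excess_controlled G2 ->
  excess_controlled (fun w => Num.max (G1 w) (G2 w)).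
Proof.
move=> GE1 GE2 al al0; have al2 : 0 < 2 * al by rewrite mulr_gt0.
have [N1 N10 h1] := GE1 _ al2; have [N2 N20 h2] := GE2 _ al2.
exists (Num.max N1 N2); first by rewrite le_max N10.
move=> Q gQ; have [i1 e1] := h1 Q gQ; have [i2 e2] := h2 Q gQ.
have m1 := itg_measurable i1; have m2 := itg_measurable i2.
have i : itg Q (fun w => Num.max (G1 w) (G2 w)).
  apply: (itg_dominated _ (itgD (itg_norm i1) (itg_norm i2))); first exact: measurable_maxr.
  apply: nearW => w; have := ler_norm (G1 w); have := ler_norm (G2 w).
  have := ler_norm (- G1 w); have := ler_norm (- G2 w); rewrite !normrN.
  rewrite ler_norml /Num.max; have := normr_ge0 (G1 w); have := normr_ge0 (G2 w).
  by case: ifP => _; lra.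
split => //.
have j1 := itg_excess N1 i1; have j2 := itg_excess N2 i2.
have le : Ex Q (fun w => Num.max (Num.max (G1 w) (G2 w) - Num.max N1 N2) 0) <=
  Ex Q (fun w => Num.max (G1 w - N1) 0) + Ex Q (fun w => Num.max (G2 w - N2) 0).
  rewrite -ExD//; apply: ae_le_Ex; [exact: itg_excess|exact: itgD|].
  apply: nearW => w.
  have a1 : 0 <= Num.max (G1 w - N1) 0 by rewrite le_max lexx orbT.
  have a2 : 0 <= Num.max (G2 w - N2) 0 by rewrite le_max lexx orbT.
  have b1 : G1 w - N1 <= Num.max (G1 w - N1) 0 by rewrite le_max lexx.
  have b2 : G2 w - N2 <= Num.max (G2 w - N2) 0 by rewrite le_max lexx.
  have n1 : N1 <= Num.max N1 N2 by rewrite le_max lexx.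
  have n2 : N2 <= Num.max N1 N2 by rewrite le_max lexx orbT.
  rewrite ge_max addr_ge0// andbT lerBlDr ge_max; apply/andP; split; lra.
have := ler_wpM2l (ltW al0) le; lra.
Qed.

Lemma ae_excess_controlled G G' : measurable_fun setT G' ->
  (\forall w \ae P, G' w = G w) -> excess_controlled G -> excess_controlled G'.
Proof.
move=> mG' GG' GE al al0; have [N N0 h] := GE al al0; exists N => // Q gQ.
have [i e] := h Q gQ; have QG := @acprob_ae _ _ _ _ Q _ GG'.
have i' : itg Q G'.
  by apply: (itg_dominated mG' (itg_norm i)); apply: filterS QG => w ->.
split => //; rewrite (@ae_eq_Ex _ _ _ _ _ (fun w => Num.max (G w - N) 0))//.
- exact: itg_measurable (itg_excess N i').
- exact: itg_measurable (itg_excess N i).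
- by apply: filterS QG => w ->.
Qed.

(** Uniform integrability in quantitative form: below N the function contributes at
    most N Q(A), above it at most the excess. *)
Lemma Ex_indic_excess (G : T -> R) (N : R) (Q : acprob P) A :
  itg Q G -> measurable A -> 0 <= N ->
  Ex Q (fun w => \1_A w * G w) <=
    N * fine (Q A) + Ex Q (fun w => Num.max (G w - N) 0).
Proof.
move=> iG mA N0; rewrite -Ex_indic// -ExZ; last exact: integrable_indic.
have iA : itg Q (fun w => N * \1_A w) by apply: itgZ; exact: integrable_indic.
rewrite -ExD//; last exact: itg_excess.
apply: ae_le_Ex; [exact: itg_indic|by apply: itgD => //; exact: itg_excess|].
apply: nearW => w; rewrite indicE.
have a1 : 0 <= Num.max (G w - N) 0 by rewrite le_max lexx orbT.
have b1 : G w - N <= Num.max (G w - N) 0 by rewrite le_max lexx.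
by case: (w \in A) => /=; lra.
Qed.

Lemma Ex_le_excess (G : T -> R) (N : R) (Q : acprob P) : itg Q G ->
  Ex Q G <= N + Ex Q (fun w => Num.max (G w - N) 0).
Proof.
move=> iG; rewrite -[X in X + _](Ex_cst Q N) -ExD; last 2 first.
- exact: itg_cst.
- exact: itg_excess.
apply: ae_le_Ex => //; first by apply: itgD; [exact: itg_cst|exact: itg_excess].
by apply: nearW => w; rewrite -lerBlDl le_max lexx.
Qed.

Lemma cvg_prob_ultralimit (Z : Type) (U : set_system Z) (q : Z -> acprob P)
    (Q : acprob P) (xi : Linf P) :
  UltraFilter U ->
  (forall xi : Linf P, Ex P (fun w => xi w * dens (q z) w) @[z --> U] -->
     Ex P (fun w => xi w * dens Q w)) ->
  Ex (q z) xi @[z --> U] --> Ex Q xi.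
Proof.
move=> UU qQ.
have E (Q' : acprob P) : Ex Q' xi = Ex P (fun w => xi w * dens Q' w).
  have [M M0 xiM] := Linf_bounded xi.
  by apply: Ex_dens; apply: (@itg_bounded _ _ _ _ _ M) => //; exact: acprob_ae.
by rewrite E; under eq_fun do rewrite E; exact: qQ.
Qed.

(** Truncated below at -M and above at N, X becomes bounded and its expectation
    converges.  The upper truncation costs the excess of G, uniformly small over
    the sublevel set; the lower one is paid only under the limit Q, where X is
    integrable. *)
Lemma excess_controlled_usc (Z : Type) (U : set_system Z) (q : Z -> acprob P)
    (Q : acprob P) (c : R) (X G : T -> R) (eps : R) :
  UltraFilter U -> (\forall z \near U, (gamma (q z) <= c%:E)%E) ->
  Qgamma gamma Q ->
  (forall xi : Linf P, Ex P (fun w => xi w * dens (q z) w) @[z --> U] -->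
     Ex P (fun w => xi w * dens Q w)) ->
  excess_controlled G -> (forall Q', Qgamma gamma Q' -> itg Q' X) ->
  (\forall w \ae P, X w <= G w) -> 0 < eps ->
  \forall z \near U, Ex (q z) X <= Ex Q X + eps.
Proof.
move=> UU qc gQ qQ GE iX XG eps0.
pose al := 3 * (`|c| + 1) / eps.
have al0 : 0 < al by rewrite divr_gt0// mulr_gt0// ltr_wpDl.
have [N N0 GN] := GE _ al0.
have eps3 : 0 < eps / 3 by rewrite divr_gt0.
have [M M0 XM] := Ex_excess_small (iX Q gQ) eps3.
have mX : measurable_fun setT X := itg_measurable (iX Q gQ).
pose Y w := Num.max (- M) (Num.min (X w) N).
have mY : measurable_fun setT Y.
  by apply: measurable_maxr => //; exact: measurable_minr.
have YMN w : `|Y w| <= M + N.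
  rewrite ler_norml /Y; apply/andP; split.
    by rewrite le_max; apply/orP; left; lra.
  rewrite ge_max ge_min; apply/andP; split; first by lra.
  by apply/orP; right; lra.
have YP : \forall w \ae P, `|Y w| <= M + N by exact: nearW.
have iY (Q' : acprob P) : itg Q' Y.
  by apply: (itg_bounded mY (M := M + N)); exact: nearW.
have := cvg_prob_ultralimit (xi := mkLinf mY YP) UU qQ.
move=> /cvgrPdist_le/(_ _ eps3).
apply: filterS2 qc => z /(Qgamma_le gamma_penalty)[gq qc] /=.
rewrite ler_norml => /andP[h1 _].
have [iG eG] := GN _ gq.
have s1 : Ex (q z) (fun w => Num.max (G w - N) 0) <= eps / 3.
  have c1 : 0 < `|c| + 1 by rewrite ltr_wpDl.
  have : al * Ex (q z) (fun w => Num.max (G w - N) 0) <= al * (eps / 3).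
    apply: le_trans eG _.
    rewrite /al (_ : _ / eps * _ = `|c| + 1); last by field; rewrite lt0r_neq0.
    by rewrite addrC lerD2r; apply: le_trans qc _; exact: ler_norm.
  by rewrite ler_pM2l.
have s2 : Ex (q z) X <= Ex (q z) Y + Ex (q z) (fun w => Num.max (G w - N) 0).
  have iGN := itg_excess N iG.
  rewrite -ExD//; apply: ae_le_Ex; [exact: iX|exact: itgD|].
  apply: filterS (@acprob_ae _ _ _ _ (q z) _ XG) => w Xw.
  have a1 : 0 <= Num.max (G w - N) 0 by rewrite le_max lexx orbT.
  have b1 : G w - N <= Num.max (G w - N) 0 by rewrite le_max lexx.
  have b2 : Num.min (X w) N <= Y w by rewrite /Y le_max lexx orbT.
  by move: b2; rewrite minEle; case: ifP => [_|/negbT]; rewrite -?ltNge; lra.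
have s3 : Ex Q Y <= Ex Q X + Ex Q (fun w => Num.max (`|X w| - M) 0).
  have iXQ := iX Q gQ; have iXM := itg_excess M (itg_norm iXQ).
  rewrite -ExD//; apply: ae_le_Ex => //; first exact: itgD.
  apply: nearW => w.
  have a1 : 0 <= Num.max (`|X w| - M) 0 by rewrite le_max lexx orbT.
  have b1 : `|X w| - M <= Num.max (`|X w| - M) 0 by rewrite le_max lexx.
  have b2 : - X w <= `|X w| by rewrite -normrN ler_norm.
  rewrite /Y ge_max; apply/andP; split; first by lra.
  by rewrite ge_min; apply/orP; left; lra.
by lra.
Qed.

End excess_control.

(** * Finite integrands, their envelopes and subgradients *)

Section finite_integrand.
Context {d : measure_display} {T : measurableType d} {R : realType}.
Variables (P : probability T R) (gamma : acprob P -> \bar R).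
Hypothesis gamma_penalty : penalty gamma.

(** The properties of f that the proof uses, after discarding a null set.  The
    fields [finite_upper] and [finite_lower] keep from the integrability
    hypotheses only what holds under each Q of finite penalty. *)
Record finite_integrand (g : T -> R -> R) : Prop := {
  finite_convex : forall w (x y t : R), 0 <= t <= 1 ->
    g w (t * x + (1 - t) * y) <= t * g w x + (1 - t) * g w y;
  finite_measurable : forall xi : T -> R, measurable_fun setT xi ->
    measurable_fun setT (fun w => g w (xi w));
  finite_upper : forall x,
    excess_controlled gamma (fun w => Num.max (g w x) 0);
  finite_lower : exists a b : T -> R, [/\ forall w, 0 <= a w,
    forall Q, Qgamma gamma Q -> itg Q a /\ itg Q b &
    forall w x, - (`|x| * a w + b w) <= g w x]
}.

Variable g : T -> R -> R.
Hypothesis g_integrand : finite_integrand g.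

Let cvx := finite_convex g_integrand.

(** By convexity, the values on [-k,k] are dominated by those at the endpoints. *)
Definition envelope (k : R) (w : T) : R :=
  Num.max (Num.max (g w k) 0) (Num.max (g w (- k)) 0).

Lemma envelope_controlled k : excess_controlled gamma (envelope k).
Proof. by apply: excess_controlled_max => //; exact: finite_upper. Qed.

Lemma envelope_ge0 k w : 0 <= envelope k w.
Proof. by rewrite !le_max lexx !orbT. Qed.

Lemma le_envelope k w x : `|x| <= k -> g w x <= envelope k w.
Proof.
rewrite ler_norml => /andP[kx xk].
have h1 : g w k <= envelope k w by rewrite !le_max lexx.
have h2 : g w (- k) <= envelope k w by rewrite !le_max lexx !orbT.
have [k0|k0] := ltP 0 k; last first.
  by rewrite (_ : x = k)//; apply/eqP; rewrite eq_le xk/=; lra.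
pose t := (x + k) / (2 * k).
have tk : t * (2 * k) = x + k by rewrite divfK//; apply: lt0r_neq0; lra.
have t0 : 0 <= t by rewrite divr_ge0//; lra.
have t1 : t <= 1 by rewrite ler_pdivrMr; lra.
have -> : x = t * k + (1 - t) * - k by lra.
by apply: le_trans (cvx _ _ _ _) _; [rewrite t0|nra].
Qed.

Lemma integrand_itg (Q : acprob P) (xi : T -> R) (k : R) :
  Qgamma gamma Q -> measurable_fun setT xi ->
  (\forall w \ae P, `|xi w| <= k) -> itg Q (fun w => g w (xi w)).
Proof.
move=> gQ mxi xik; have [a [b [a0 /(_ Q gQ)[ia ib] gab]]] := finite_lower g_integrand.
have iG := excess_controlled_itg (envelope_controlled k) gQ.
apply: (@itg_dominated _ _ _ _ _ (fun w => envelope k w + (k * a w + `|b w|))).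
- exact: finite_measurable.
- by apply: itgD => //; apply: itgD; [exact: itgZ|exact: itg_norm].
- apply: filterS (@acprob_ae _ _ _ _ Q _ xik) => w wk.
  have h1 := le_envelope w wk; have h2 := gab w (xi w); have h3 := envelope_ge0 k w.
  have h4 : `|xi w| * a w <= k * a w by rewrite ler_wpM2r.
  have h5 : 0 <= k * a w by rewrite mulr_ge0//; exact: le_trans wk.
  have h6 := ler_norm (b w); have h7 := normr_ge0 (b w).
  by rewrite ler_norml; apply/andP; split; lra.
Qed.

Definition Jfun (xi : T -> R) (Q : acprob P) : R := Ex Q (fun w => g w (xi w)).

Lemma integrand_Linf_itg (Q : acprob P) (xi : Linf P) : Qgamma gamma Q ->
  itg Q (fun w => g w (xi w)).
Proof. by move=> gQ; have [k _ xik] := Linf_bounded xi; exact: integrand_itg xik. Qed.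

Lemma three_point w (x y z : R) : x < y -> y < z ->
  (g w y - g w x) / (y - x) <= (g w z - g w y) / (z - y).
Proof.
move=> xy yz; have xy0 : 0 < y - x by rewrite subr_gt0.
have yz0 : 0 < z - y by rewrite subr_gt0.
have xz0 : 0 < z - x by lra.
pose t := (z - y) / (z - x).
have tz : t * (z - x) = z - y by rewrite divfK// lt0r_neq0.
have t0 : 0 <= t by rewrite divr_ge0// ltW.
have t1 : t <= 1 by rewrite ler_pdivrMr//; lra.
have := cvx w x z (t := t); rewrite t0 t1 => /(_ isT).
have -> : t * x + (1 - t) * z = y by lra.
move=> h; rewrite ler_pdivrMr// mulrAC ler_pdivlMr//.
have h' : (z - x) * g w y <= (z - x) * (t * g w x + (1 - t) * g w z).
  by rewrite ler_pM2l.
have e1 : (z - x) * (t * g w x + (1 - t) * g w z) =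
    (t * (z - x)) * g w x + (z - x - t * (z - x)) * g w z by ring.
by rewrite e1 tz in h'; nra.
Qed.

Definition slope (xi : T -> R) (n : nat) (w : T) : R :=
  (g w (xi w + n.+1%:R^-1) - g w (xi w)) / n.+1%:R^-1.

(** Defined as the limit of a sequence of difference quotients, the right derivative
    inherits measurability from g; this avoids a measurable selection theorem for
    the subdifferential. *)
Definition right_derivative (xi : T -> R) (w : T) : R := limn (slope xi ^~ w).

Lemma slope_ge xi n w x : x < xi w ->
  (g w (xi w) - g w x) / (xi w - x) <= slope xi n w.
Proof.
move=> xxi; have n0 : (0 : R) < n.+1%:R^-1 by rewrite invr_gt0.
have := @three_point w x (xi w) (xi w + n.+1%:R^-1) xxi.
by rewrite addrAC subrr add0r; apply; rewrite ltrDl.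
Qed.

Lemma slope_le xi n w x : xi w + n.+1%:R^-1 <= x ->
  slope xi n w <= (g w x - g w (xi w)) / (x - xi w).
Proof.
move=> nx; have n0 : (0 : R) < n.+1%:R^-1 by rewrite invr_gt0.
set e := n.+1%:R^-1 in nx n0 *.
move: nx; rewrite le_eqVlt => /predU1P[<-|nx].
  by rewrite /slope -/e addrAC subrr add0r.
have x0 : 0 < x - xi w by lra.
have xe0 : 0 < x - (xi w + e) by lra.
have := @three_point w (xi w) (xi w + e) x; rewrite ltrDl => /(_ n0 nx).
rewrite addrAC subrr add0r /slope -/e.
rewrite ler_pdivrMr// mulrAC ler_pdivlMr// => h.
by rewrite ler_pdivrMr// mulrAC ler_pdivlMr//; nra.
Qed.

Lemma slope_cvg xi w : slope xi n w @[n --> \oo] --> right_derivative xi w.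
Proof.
apply: nonincreasing_is_cvgn.
  apply/nonincreasing_seqP => n; rewrite {2}/slope.
  have := @slope_le xi n.+1 w (xi w + n.+1%:R^-1).
  rewrite addrAC subrr add0r; apply.
  by rewrite lerD2l lef_pV2 ?posrE// ler_nat.
exists ((g w (xi w) - g w (xi w - 1)) / (xi w - (xi w - 1))) => _ [n _ <-].
by apply: slope_ge; rewrite ltrBlDr ltrDl.
Qed.

Lemma right_derivative_subgradient xi w x :
  right_derivative xi w * (x - xi w) <= g w x - g w (xi w).
Proof.
have [xxi|xxi|->] := ltgtP x (xi w); last by rewrite !subrr mulr0.
- have x0 : 0 < xi w - x by rewrite subr_gt0.
  have : (g w (xi w) - g w x) / (xi w - x) <= right_derivative xi w.
    apply: limr_ge; first by apply/cvg_ex; eexists; exact: slope_cvg.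
    by apply: nearW => n; exact: slope_ge.
  by rewrite ler_pdivrMr//; lra.
- have x0 : 0 < x - xi w by rewrite subr_gt0.
  have : right_derivative xi w <= (g w x - g w (xi w)) / (x - xi w).
    apply: limr_le; first by apply/cvg_ex; eexists; exact: slope_cvg.
    have : \forall n \near \oo, n.+1%:R^-1 <= x - xi w.
      near=> n; rewrite -[leRHS]invrK lef_pV2 ?posrE ?invr_gt0//.
      apply/ltW; apply: (@lt_le_trans _ _ (Num.truncn (x - xi w)^-1).+1%:R).
        by rewrite truncnS_gt.
      by rewrite ler_nat ltnS; near: n; exact: nbhs_infty_ge.
    by apply: filterS => n nx; apply: slope_le; rewrite -lerBrDl.
  by rewrite ler_pdivlMr.
Unshelve. all: by end_near. Qed.

Lemma right_derivative_bound xi w :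
  `|right_derivative xi w| <=
    `|g w (xi w + 1) - g w (xi w)| + `|g w (xi w) - g w (xi w - 1)|.
Proof.
have h1 := right_derivative_subgradient xi w (xi w + 1).
have h2 := right_derivative_subgradient xi w (xi w - 1).
have n1 := ler_norm (g w (xi w + 1) - g w (xi w)).
have n2 := ler_norm (- (g w (xi w) - g w (xi w - 1))).
have p1 := normr_ge0 (g w (xi w + 1) - g w (xi w)).
have p2 := normr_ge0 (g w (xi w) - g w (xi w - 1)).
rewrite normrN in n2; rewrite ler_norml; apply/andP; split; lra.
Qed.

(** With -eta equal to the density of Q times a subgradient of g at xi, the
    subgradient inequality at xi' integrates to the claim.  It says that the
    Fenchel-Young inequality between xi and -eta is an equality. *)
Lemma exists_subgradient (xi : Linf P) (Q : acprob P) : Qgamma gamma Q ->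
  exists eta : L1 P, forall xi' : Linf P,
    - Ex P (fun w => xi' w * eta w) - Jfun xi' Q <=
    - Ex P (fun w => xi w * eta w) - Jfun xi Q.
Proof.
move=> gQ; have [k k0 xik] := Linf_bounded xi.
pose s := right_derivative xi.
have mxi : measurable_fun setT xi by [].
have mp (c : R) : measurable_fun setT (fun w => g w (xi w + c)).
  by apply: finite_measurable => //; apply: measurable_funD.
have ms : measurable_fun setT s.
  apply: (@measurable_fun_cvg _ _ _ setT (slope xi)) => [n|w _].
    apply: measurable_funM; last exact: measurable_cst.
    by apply: measurable_funB; [exact: mp|exact: (finite_measurable g_integrand)].
  exact: slope_cvg.
have ip (c : R) : itg Q (fun w => g w (xi w + c)).
  apply: (@integrand_itg Q (fun w => xi w + c) (k + `|c|)) => //.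
    exact: measurable_funD.
  by apply: filterS xik => w wk; apply: le_trans (ler_normD _ _) _; lra.
have i0 := integrand_Linf_itg xi gQ.
have is_ : itg Q s.
  apply: (itg_dominated ms (itgD (itg_norm (itgB (ip 1) i0)) (itg_norm (itgB i0 (ip (-1)))))).
  by apply: nearW => w; exact: right_derivative_bound.
have iN := itgN (itg_dens is_).
exists (mkL1 iN) => xi'.
have E (ze : Linf P) : - Ex P (fun w => ze w * mkL1 iN w) =
    Ex Q (fun w => ze w * s w).
  have [k' _ zek] := Linf_bounded ze.
  have mze : measurable_fun setT ze by [].
  rewrite Ex_dens; last exact: (itgM mze (@acprob_ae _ _ _ _ Q _ zek)).
  rewrite -ExN; last exact: Linf_itgM.
  by congr (Ex P _); apply/funext => w /=; ring.
have iM (ze : Linf P) : itg Q (fun w => ze w * s w).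
  have [k' _ zek] := Linf_bounded ze.
  have mze : measurable_fun setT ze by [].
  exact: (itgM mze (@acprob_ae _ _ _ _ Q _ zek)).
have i' := integrand_Linf_itg xi' gQ.
rewrite !E /Jfun -!ExB//.
apply: ae_le_Ex; [exact: itgB|exact: itgB|].
apply: nearW => w; have := right_derivative_subgradient xi w (xi' w).
by rewrite -/s; lra.
Qed.

End finite_integrand.

(** * Attainment in the dual problem *)

Section dual_attainment.
Context {d : measure_display} {T : measurableType d} {R : realType}.
Variables (P : probability T R) (gamma : acprob P -> \bar R).
Hypothesis gamma_penalty : penalty gamma.
Variable g : T -> R -> R.
Hypothesis g_integrand : finite_integrand gamma g.

Let J (xi : T -> R) (Q : acprob P) := Jfun g xi Q.
Let pr (xi : T -> R) (eta : L1 P) : R := Ex P (fun w => xi w * eta w).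

Let pr_comb t (xi1 xi2 : Linf P) eta :
  pr (fun w => t * xi1 w + (1 - t) * xi2 w) eta = t * pr xi1 eta + (1 - t) * pr xi2 eta.
Proof.
have i1 := Linf_itgM xi1 (L1_itg eta); have i2 := Linf_itgM xi2 (L1_itg eta).
rewrite /pr -!ExZ// -ExD; [|exact: itgZ|exact: itgZ].
by congr (Ex P _); apply/funext => w; ring.
Qed.

(** J(xi0,Q) grows at most like half of the penalty, by the control of the excess of
    the envelope with factor 2, so the penalty is bounded on superlevel sets. *)
Lemma level_penalty_bounded (xi0 : Linf P) (c : R) :
  exists c1 : R, forall Q, Qgamma gamma Q ->
    c <= J xi0 Q - gam gamma Q -> (gamma Q <= c1%:E)%E.
Proof.
have [k _ xik] := Linf_bounded xi0.
have [N N0 NP] := envelope_controlled g_integrand k (ltr0Sn R 1).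
exists (2 * N + 1 - 2 * c) => Q gQ cQ; have [iG eG] := NP Q gQ.
have h := Ex_le_excess N iG.
have h' : J xi0 Q <= Ex Q (envelope g k).
  apply: ae_le_Ex => //; first exact: (integrand_Linf_itg g_integrand).
  by apply: filterS (@acprob_ae _ _ _ _ Q _ xik) => w; exact: (le_envelope g_integrand).
by rewrite (gamE gamma_penalty gQ) lee_fin; lra.
Qed.

(** The test function xi0 - k sgn(eta) 1_A produces k E[|eta| 1_A] on the left; on
    the right g at this function is at most the envelope at level k0, whose
    expectation is bounded independently of k, plus on A the envelope at level
    k0 + k. *)
Lemma level_density_bound (xi0 : Linf P) (c c1 : R) :
  exists C1 : R, forall k : R, 0 < k -> exists2 N : R, 0 <= N &
    forall (eta : L1 P) Q A, Qgamma gamma Q -> (gamma Q <= c1%:E)%E ->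
      measurable A ->
      (forall xi : Linf P, pr xi0 eta - pr xi eta <= J xi Q - gam gamma Q - c) ->
      k * Ex P (fun w => \1_A w * `|eta w|) <= C1 + N * fine (Q A).
Proof.
have [k0 k00 xik] := Linf_bounded xi0.
have [N0 N00 NP0] := envelope_controlled g_integrand k0 (ltr0Sn R 1).
exists (N0 + (1 + c1) / 2 + (1 + c1) - c) => k kp.
have [N Np NP] := envelope_controlled g_integrand (k0 + k) ltr01.
exists N => // eta Q A gQ /(Qgamma_le gamma_penalty)[_ Qc1] mA lev.
have [iG0 eG0] := NP0 Q gQ; have [iG eG] := NP Q gQ.
pose sg w : R := k * (\1_A w * Num.sg (eta w)).
have msg : measurable_fun setT sg.
  apply: measurable_funM => //; apply: measurable_funM => //.
  rewrite (_ : (fun w => _) =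
      fun w => if 0 < eta w then 1 else if eta w < 0 then -1 else 0 : R).
    apply: measurable_fun_ifT => //; first by apply: measurable_fun_ltr.
    by apply: measurable_fun_ifT => //; apply: measurable_fun_ltr.
  apply/funext => w; case: (ltgtP 0 (eta w)) => [h|h|<-].
  - by rewrite gtr0_sg.
  - by rewrite ltr0_sg.
  - by rewrite sgr0.
have sgk w : `|sg w| <= k.
  have s1 : `|Num.sg (eta w)| <= 1 by rewrite normr_sg; case: (_ == _).
  rewrite /sg normrM gtr0_norm// ger_pMr// indicE.
  by case: (w \in A); rewrite ?mul1r ?mul0r ?normr0.
pose X w := xi0 w - sg w.
have mX : measurable_fun setT X by exact: measurable_funB.
have XP : \forall w \ae P, `|X w| <= k0 + k.
  apply: filterS xik => w wk; apply: le_trans (ler_normB _ _) _.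
  by have := sgk w; lra.
have := lev (mkLinf mX XP).
have ieta := L1_itg eta.
have iA : itg P (fun w => \1_A w * `|eta w|) by apply: itg_indic => //; exact: itg_norm.
have -> : pr xi0 eta - pr (mkLinf mX XP) eta = k * Ex P (fun w => \1_A w * `|eta w|).
  rewrite /pr -ExB; [|exact: Linf_itgM|exact: Linf_itgM].
  rewrite -ExZ//; congr (Ex P _); apply/funext => w /=.
  by rewrite /X /sg -mulrBl opprB addrC subrK -!mulrA -normrEsg.
move=> h; apply: le_trans h _.
have iGA := itg_indic mA iG.
have hJ : J (mkLinf mX XP) Q <=
    Ex Q (envelope g k0) + Ex Q (fun w => \1_A w * envelope g (k0 + k) w).
  rewrite -ExD//; apply: ae_le_Ex; [exact: (integrand_Linf_itg g_integrand)|exact: itgD|].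
  apply: filterS2 (@acprob_ae _ _ _ _ Q _ XP) (@acprob_ae _ _ _ _ Q _ xik) => w wX wxi /=.
  have e0 := envelope_ge0 g k0 w; have e1 := envelope_ge0 g (k0 + k) w.
  rewrite indicE; have [wA|wA] := boolP (w \in A).
    by rewrite mul1r; have := le_envelope g_integrand w wX; lra.
  rewrite mul0r addr0 /X /sg indicE (negbTE wA) mul0r mulr0 subr0.
  exact: (le_envelope g_integrand).
have h0 := Ex_le_excess N0 iG0.
have h1 := Ex_indic_excess iG mA Np.
have g0 := gam_ge0 gamma_penalty Q.
by lra.
Qed.

(** Weak compactness of the superlevel sets, together with the upper semicontinuity
    of the terms depending on Q.  Uniform countable additivity of the densities
    follows from [level_density_bound] by choosing k large, then A with Q(A)
    uniformly small. *)
Lemma level_compact (Z : Type) (U : set_system Z) (e : Z -> L1 P)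
    (q : Z -> acprob P) (xi0 : Linf P) (c : R) :
  UltraFilter U ->
  (\forall z \near U, Qgamma gamma (q z) /\ forall xi : Linf P,
     pr xi0 (e z) - pr xi (e z) <= J xi (q z) - gam gamma (q z) - c) ->
  exists (eta : L1 P) (Q : acprob P),
    [/\ Qgamma gamma Q,
        forall xi : Linf P, pr xi (e z) @[z --> U] --> pr xi eta &
        forall (xi : Linf P) eps, 0 < eps -> \forall z \near U,
          J xi (q z) - gam gamma (q z) <= J xi Q - gam gamma Q + eps].
Proof.
move=> UU lev.
have [c1 c1P] := level_penalty_bounded xi0 c.
have qc1 : \forall z \near U, (gamma (q z) <= c1%:E)%E.
  apply: filterS lev => z [gq /(_ xi0)]; rewrite subrr => h.
  by apply: c1P => //; lra.
have [C1 C1P] := level_density_bound xi0 c c1.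
have [|A mA dA A0 eps eps0|eta etaP] :=
    @dunford_pettis _ _ _ P Z U UU e (C1 + sval (cid2 (C1P 1 ltr01))).
- case: cid2 => N N0 /= NP; apply: filterS2 lev qc1 => z [gq lv] qc.
  have := NP _ _ _ gq qc measurableT lv.
  rewrite probability_setT /= mulr1 mul1r; apply: le_trans.
  rewrite le_eqVlt; apply/orP; left; apply/eqP.
  by congr (Ex P _); apply/funext => w; rewrite indicT mul1r.
-
  (* [k] is so large that the bound [C1] divided by [k] is below [eps / 2] *)
  pose k := 2 * (`|C1| + 1) / eps.
  have C10 : 0 < `|C1| + 1 by rewrite ltr_wpDl.
  have kp : 0 < k by rewrite divr_gt0// mulr_gt0.
  have keps : k * eps = 2 * (`|C1| + 1) by rewrite divfK// lt0r_neq0.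
  have [N N0 NP] := C1P k kp.
  have N1 : 0 < N + 1 by rewrite ltr_wpDl.
  have [|n nP] := penalty_sublevel_tail gamma_penalty c1 mA dA A0 (eps := (N + 1)^-1).
    by rewrite invr_gt0.
  exists n; apply: filterS2 lev qc1 => z [gq lv] qc.
  have h1 := NP _ _ _ gq qc (mA n) lv; have h2 := nP _ qc.
  have h3 : N * fine (q z (A n)) <= 1.
    apply: le_trans (ler_wpM2l N0 h2) _.
    by rewrite ler_pdivrMr// mul1r; lra.
  rewrite -(ler_pM2l kp) keps; have := ler_norm C1; lra.
have [Q [gQ Qcvg Qlsc]] := penalty_ultralimit gamma_penalty UU qc1.
exists eta, Q; split => // xi eps eps0.
have eps2 : 0 < eps / 2 by rewrite divr_gt0.
have [k k0 xik] := Linf_bounded xi.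
have iX Q' : Qgamma gamma Q' -> itg Q' (fun w => g w (xi w)).
  exact: (integrand_Linf_itg g_integrand).
have Xenv : \forall w \ae P, g w (xi w) <= envelope g k w.
  by apply: filterS xik => w; exact: (le_envelope g_integrand).
have h1 := excess_controlled_usc gamma_penalty UU qc1 gQ Qcvg
  (envelope_controlled g_integrand k) iX Xenv eps2.
have h2 : \forall z \near U, gam gamma Q - eps / 2 < gam gamma (q z).
  by apply: Qlsc; lra.
by apply: filterS2 h1 h2 => z; rewrite /J /Jfun; lra.
Qed.

(** The points of the dual problem are triples (eta,Q,c), where the real number c
    bounds H(-eta|Q) from above: with this variable the functions k are
    real-valued and no epigraph or extended value enters the minimax argument.
    An ultrafilter containing all sets where finitely many k exceed levels
    below m converges to an optimal pair. *)
Theorem dual_attained (C : set (Linf P)) (m : R) :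
  C !=set0 ->
  (forall xi1 xi2 t, C xi1 -> C xi2 -> 0 <= t <= 1 ->
     C (t *: xi1 + (1 - t) *: xi2)) ->
  (forall xi, C xi -> forall m', m' < m ->
     exists2 Q, Qgamma gamma Q & m' < J xi Q - gam gamma Q) ->
  exists (eta : L1 P) (Q : acprob P), Qgamma gamma Q /\
    forall xi xi' : Linf P, C xi ->
      m <= pr xi' eta - pr xi eta + J xi' Q - gam gamma Q.
Proof.
move=> [xi0 Cxi0] Ccvx Cm.
pose Z := (L1 P * acprob P * R)%type.
pose D : set Z := [set z | Qgamma gamma z.1.2 /\
  forall xi : Linf P, - pr xi z.1.1 - J xi z.1.2 <= z.2].
pose k (xi : Linf P) (z : Z) : R := - pr xi z.1.1 - z.2 - gam gamma z.1.2.
have Dsup xi m' : C xi -> m' < m -> exists2 z, D z & m' < k xi z.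
  move=> Cxi m'm; have [Q gQ mQ] := Cm xi Cxi m' m'm.
  have [eta etaP] := exists_subgradient g_integrand xi gQ.
  exists (eta, Q, - pr xi eta - J xi Q); first by split.
  by rewrite /k /=; lra.
have kaff i j t : C i -> C j -> 0 <= t <= 1 ->
    exists2 l, C l & forall z, D z -> k l z <= t * k i z + (1 - t) * k j z.
  move=> Ci Cj t01; exists (t *: i + (1 - t) *: j); first exact: Ccvx.
  move=> z _; rewrite /k.
  have -> : pr (t *: i + (1 - t) *: j) z.1.1 = t * pr i z.1.1 + (1 - t) * pr j z.1.1.
    by rewrite -pr_comb.
  by lra.
have Dccv z1 z2 t : D z1 -> D z2 -> 0 <= t <= 1 ->
    exists2 z, D z & forall i, t * k i z1 + (1 - t) * k i z2 <= k i z.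
  case: z1 z2 => [[eta1 Q1] c1] [[eta2 Q2] c2] [/= g1 h1] [/= g2 h2] t01.
  have [Q [gQ Qle _ Qexp]] := penalty_convex_combination gamma_penalty t01 g1 g2.
  pose eta := t *: eta1 + (1 - t) *: eta2.
  have etaE (xi : Linf P) : pr xi eta = t * pr xi eta1 + (1 - t) * pr xi eta2.
    have i1 := Linf_itgM xi (L1_itg eta1); have i2 := Linf_itgM xi (L1_itg eta2).
    rewrite /pr -!ExZ// -ExD; [|exact: itgZ|exact: itgZ].
    congr (Ex P _); apply/funext => w.
    have -> : eta w = t * eta1 w + (1 - t) * eta2 w by [].
    by ring.
  exists (eta, Q, t * c1 + (1 - t) * c2) => [|xi]; last by rewrite /k /= etaE; lra.
  split => //= xi; have JE : J xi Q = t * J xi Q1 + (1 - t) * J xi Q2.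
    by apply: Qexp; exact: (integrand_Linf_itg g_integrand).
  case/andP: t01 => t0 t1; rewrite etaE JE.
  have := ler_wpM2l t0 (h1 xi).
  have := ler_wpM2l (_ : 0 <= 1 - t) (h2 xi); rewrite subr_ge0 => /(_ t1); lra.
pose B (sm : seq (Linf P) * R) : set Z :=
  [set z | D z /\ forall xi, xi \in sm.1 -> sm.2 < k xi z].
pose F := filter_from
  [set sm : seq (Linf P) * R | sm.2 < m /\ forall xi, xi \in sm.1 -> C xi] B.
have FF : ProperFilter F.
  apply: filter_from_proper.
    apply: filter_from_filter.
      by exists ([::], m - 1); split => //=; lra.
    move=> [s1 m1] [s2 m2] [/= m1m s1C] [/= m2m s2C].
    exists (s1 ++ s2, Num.max m1 m2) => /=.
      split => /=; first by rewrite gt_max m1m.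
      by move=> xi; rewrite mem_cat => /orP[/s1C|/s2C].
    move=> z [Dz zP]; split; split => // xi xis /=.
    - apply: le_lt_trans (zP xi _) => /=; first by rewrite le_max lexx.
      by rewrite mem_cat xis.
    - apply: le_lt_trans (zP xi _) => /=; first by rewrite le_max lexx orbT.
      by rewrite mem_cat xis orbT.
  move=> [s m'] [/= m'm sC].
  have [||||| z Dz zs] := @finite_minimax R (Linf P) Z C k m' s D => //.
  - by move=> xi Cxi; exact: Dsup.
  - by have [z Dz _] := Dsup xi0 m' Cxi0 m'm; exists z.
  - by exists z.
have [U [UU FU]] := ultraFilterLemma FF.
have near_k xi m' : C xi -> m' < m -> \forall z \near U, D z /\ m' < k xi z.
  move=> Cxi m'm; apply: FU; exists ([:: xi], m') => /=.
    by split => //= xi'; rewrite inE => /eqP ->.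
  by move=> z [Dz zP]; split => //; apply: zP; rewrite inE.
have [|eta [Q [gQ etacvg Jle]]] :=
    @level_compact Z U (fun z => z.1.1) (fun z => z.1.2) xi0 (m - 1) UU.
  have m1 : m - 1 < m by lra.
  apply: filterS (near_k xi0 (m - 1) Cxi0 m1) => z [[gz zD] kz]; split => // xi.
  by have := zD xi; move: kz; rewrite /k; lra.
exists eta, Q; split => // xi xi' Cxi; apply/ler_addgt0Pr => eps eps0.
have eps4 : 0 < eps / 4 by rewrite divr_gt0.
have m4 : m - eps / 4 < m by lra.
have h1 := near_k xi _ Cxi m4.
have h2 := Jle xi' _ eps4.
have /cvgrPdist_le/(_ _ eps4) h3 := etacvg xi.
have /cvgrPdist_le/(_ _ eps4) h4 := etacvg xi'.
have [z [[[z1 z2] z3] z4]] :=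
  @filter_ex _ U _ _ (filterI (filterI (filterI h1 h2) h3) h4).
move: z1 z2 z3 z4 => [[_ /(_ xi') zD] kz] /=.
rewrite !ler_norml => a /andP[b1 b2] /andP[b3 b4].
by move: kz; rewrite /k; lra.
Qed.

End dual_attainment.

(** * The conjugate functional as a supremum over bounded functions *)

Section conjugate_integral.
Context {d : measure_display} {T : measurableType d} {R : realType}.
Variable P : probability T R.

(** Y may have an infinite positive part, but its negative part is dominated by that
    of X. *)
Lemma le_Ex_integral (X : T -> R) (Y : T -> \bar R) : itg P X ->
  measurable_fun setT Y -> (\forall w \ae P, ((X w)%:E <= Y w)%E) ->
  ((Ex P X)%:E <= \int[P]_w Y w)%E.
Proof.
move=> iX mY XY; rewrite EFin_Ex// integralE [leRHS]integralE.
have mX : measurable_fun setT (EFin \o X) := measurable_int _ iX.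
apply: leeB; apply: ae_ge0_le_integral => //.
- exact: measurable_funepos.
- exact: measurable_funepos.
- by apply: filterS XY => w XYw _; rewrite !funeposE ge_max le_max XYw/= le_max lexx orbT.
- exact: measurable_funeneg.
- exact: measurable_funeneg.
- apply: filterS XY => w XYw _; rewrite !funenegE ge_max le_max leeN2 XYw/=.
  by rewrite le_max lexx orbT.
Qed.

Hypothesis P_complete : measure_is_complete P.
Variable gamma : acprob P -> \bar R.
Variables (g : T -> R -> R) (f : T -> R -> \bar R).
Hypothesis g_integrand : finite_integrand gamma g.
Hypothesis fg : \forall w \ae P, forall x, f w x = (g w x)%:E.

Section fixed_arguments.
Variables (eta : L1 P) (Q : acprob P).
Hypothesis gQ : Qgamma gamma Q.

Let v (w : T) (x : R) : R := x * eta w - dens Q w * g w x.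

Let qn (n : nat) : R := if unpickle n is Some r then ratr (r : rat) else 0.

(** Since g is continuous in x, rational points suffice for the supremum defining the
    conjugate; choosing successively among them gives measurable bounded
    selections along which v increases to this supremum. *)
Fixpoint best (n : nat) (w : T) : R :=
  if n is m.+1 then
    if v w (best m w) < v w (qn m) then qn m else best m w
  else 0.

Let measurable_v (X : T -> R) : measurable_fun setT X ->
  measurable_fun setT (fun w => v w (X w)).
Proof.
move=> mX; apply: measurable_funB; first exact: measurable_funM.
by apply: measurable_funM => //; exact: (finite_measurable g_integrand).
Qed.

Let measurable_best n : measurable_fun setT (best n).
Proof.
elim: n => [|n ih] /=; first exact: measurable_cst.
apply: measurable_fun_ifT => //.
by apply: measurable_fun_ltr; exact: measurable_v.
Qed.

Let best_bounded n : exists M : R, forall w, `|best n w| <= M.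
Proof.
elim: n => [|n [M hM]] /=; first by exists 0 => w; rewrite normr0.
exists (`|qn n| + M) => w; have M0 := le_trans (normr_ge0 _) (hM w).
case: ifP => _; first by rewrite lerDl.
by apply: le_trans (hM w) _; rewrite lerDr.
Qed.

Let phi n w := v w (best n w).

Let phi_nd w m n : (m <= n)%N -> phi m w <= phi n w.
Proof.
elim: n => [|n ih]; first by rewrite leqn0 => /eqP ->.
rewrite leq_eqVlt => /predU1P[->//|]; rewrite ltnS => /ih mn.
apply: le_trans mn _; rewrite /phi /=.
by case: ifP => // /ltW.
Qed.

Let v_qn w n : v w (qn n) <= phi n.+1 w.
Proof. by rewrite /phi /=; case: ifP => // /negbT; rewrite -leNgt. Qed.

Let best_Linf n : exists xi : Linf P, xi = best n :> (T -> R).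
Proof.
have [M hM] := best_bounded n.
have hM' : \forall w \ae P, `|best n w| <= M by exact: nearW.
by exists (mkLinf (measurable_best n) hM').
Qed.

Let v_itg (xi : Linf P) : itg P (fun w => v w (xi w)) /\
  Ex P (fun w => v w (xi w)) = Ex P (fun w => xi w * eta w) - Jfun g xi Q.
Proof.
have i1 := Linf_itgM xi (L1_itg eta).
have i2 := integrand_Linf_itg g_integrand xi gQ.
have i3 := itg_dens i2.
have E : (fun w => v w (xi w)) =
    (fun w => xi w * eta w - g w (xi w) * dens Q w).
  by apply/funext => w; rewrite /v [dens Q w * _]mulrC.
by rewrite E; split; [exact: itgB|rewrite ExB// /Jfun -Ex_dens].
Qed.

Let phi_itg n : itg P (phi n).
Proof. by have [xi E] := best_Linf n; have [] := v_itg xi; rewrite E. Qed.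

Let v_rational w (x eps : R) : 0 <= dens Q w -> 0 < eps ->
  exists n, v w x - eps <= v w (qn n).
Proof.
move=> D0 eps0; pose K := `|eta w| + `|dens Q w * (g w (x + 1) - g w x)|.
have K0 : 0 <= K by rewrite addr_ge0.
have K1 : 0 < K + 1 by rewrite ltr_wpDl.
pose del := Num.min 1 (eps / (K + 1)).
have del0 : 0 < del by rewrite lt_min ltr01 divr_gt0.
have xdel : x < x + del by rewrite ltrDl.
have [r] := rat_in_itvoo xdel; rewrite in_itv/= => /andP[xr rx].
exists (pickle r); rewrite /qn pickleK.
pose s : R := ratr r - x.
have s0 : 0 < s by rewrite subr_gt0.
have sdel : s < del by rewrite /s; lra.
have s1 : s <= 1 by apply: ltW; apply: lt_le_trans sdel _; rewrite ge_min lexx.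
have sK : s * (K + 1) <= eps.
  by rewrite -ler_pdivlMr//; apply: ltW; apply: lt_le_trans sdel _; rewrite ge_min lexx orbT.
have rE : ratr r = s * (x + 1) + (1 - s) * x by rewrite /s; ring.
have s01 : 0 <= s <= 1 by rewrite (ltW s0).
have := finite_convex g_integrand w (x + 1) x s01; rewrite -rE => cvx.
have h1 := ler_wpM2l D0 cvx.
have h2 : - `|eta w| <= eta w by have := ler_norm (- eta w); rewrite normrN; lra.
have h3 := ler_norm (dens Q w * (g w (x + 1) - g w x)).
have h4 : s * - K <= s * (eta w - dens Q w * (g w (x + 1) - g w x)).
  by rewrite ler_pM2l// /K; lra.
have rE' : ratr r = x + s by rewrite /s; ring.
by rewrite /v rE' in h1 *; rewrite /v; nra.
Qed.

Let excess (w : T) : \bar R := limn (fun n => (phi n w - phi 0%N w)%:E).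

Let excess_nd w : nondecreasing_seq (fun n => (phi n w - phi 0%N w)%:E).
Proof. by move=> m n mn; rewrite lee_fin lerD2r; exact: phi_nd. Qed.

Let excessE w :
  excess w = ereal_sup (range (fun n => (phi n w - phi 0%N w)%:E)).
Proof. by apply/cvg_lim => //; exact: ereal_nondecreasing_cvgn (excess_nd w). Qed.

Let measurable_excess : measurable_fun setT excess.
Proof.
apply: (@emeasurable_fun_cvg _ _ _ _ (fun n w => (phi n w - phi 0%N w)%:E)) => [n|w _].
  by apply/measurable_EFinP; apply: measurable_funB; exact: measurable_v.
by rewrite excessE; exact: ereal_nondecreasing_cvgn (excess_nd w).
Qed.

(** Restricted to points where the density is nonnegative: there the convexity of g
    bounds from below the values of v at rationals slightly larger than x. *)
Let conj_tildeE : \forall w \ae P,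
  conj_tilde f w (eta w) (dens Q w) = (excess w + (phi 0%N w)%:E)%E.
Proof.
apply: filterS2 fg (dens_ge0 Q) => w fgw D0.
have le_conj x : ((v w x)%:E <= conj_tilde f w (eta w) (dens Q w))%E.
  apply: ereal_sup_ubound; exists x; first by rewrite /= fgw ltry.
  by rewrite fgw -EFinM -EFinB.
apply/eqP; rewrite eq_le; apply/andP; split; last first.
  rewrite -leeBrDr// excessE; apply: ge_ereal_sup => _ [n _ <-].
  by rewrite leeBrDr// -EFinD subrK; exact: le_conj.
apply: ge_ereal_sup => _ [x _ <-]; rewrite fgw -EFinM -EFinB -/(v w x).
rewrite -leeBlDr// -EFinB excessE.
apply/lee_addgt0Pr => eps eps0.
have [n hn] := v_rational x D0 eps0.
apply: (@le_trans _ _ ((phi n.+1 w - phi 0%N w)%:E + eps%:E)%E).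
  by rewrite -EFinD lee_fin; have := v_qn w n; lra.
by rewrite leeD2r//; apply: ereal_sup_ubound; exists n.+1.
Qed.

Let measurable_conj_tilde :
  measurable_fun setT (fun w => conj_tilde f w (eta w) (dens Q w)).
Proof.
apply: (ae_measurable_fun P_complete (f := fun w => (excess w + (phi 0%N w)%:E)%E)).
  by apply: filterS conj_tildeE => w ->.
apply: emeasurable_funD => //; apply/measurable_EFinP; exact: measurable_v.
Qed.

Lemma Hcond_ge (xi : Linf P) :
  ((Ex P (fun w => xi w * eta w) - Jfun g xi Q)%:E <= Hcond f eta Q)%E.
Proof.
have [i <-] := v_itg xi; apply: le_Ex_integral => //.
apply: filterS fg => w fgw.
apply: ereal_sup_ubound; exists (xi w); first by rewrite /= fgw ltry.
by rewrite fgw -EFinM -EFinB.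
Qed.

(** Monotone convergence along the selections [best].  Completeness of P makes the
    integrand measurable, as it agrees with the measurable limit only almost
    everywhere. *)
Lemma Hcond_le (c : R) :
  (forall xi : Linf P, Ex P (fun w => xi w * eta w) - Jfun g xi Q <= c) ->
  (Hcond f eta Q <= c%:E)%E.
Proof.
move=> cP; have phic n : Ex P (phi n) <= c.
  have [xi E] := best_Linf n; have [_] := v_itg xi.
  by rewrite E -/(phi n) => ->; rewrite -E.
have i0 := phi_itg 0%N.
have m0 : measurable_fun setT (fun w => (phi 0%N w)%:E) by exact: measurable_int i0.
have excess_ge0 w : (0 <= excess w)%E.
  by rewrite excessE; apply: ereal_sup_ubound; exists 0%N => //; rewrite subrr.
have intE : (\int[P]_w excess w <= (c - Ex P (phi 0%N))%:E)%E.
  rewrite /excess monotone_convergence//.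
  - apply: lime_le.
      apply: ereal_nondecreasing_is_cvgn => m n mn.
      apply: ge0_le_integral => //.
      + by move=> w _; rewrite lee_fin subr_ge0; exact: phi_nd.
      + by apply/measurable_EFinP; apply: measurable_funB; exact: measurable_v.
      + by apply/measurable_EFinP; apply: measurable_funB; exact: measurable_v.
      + by move=> w _; exact: excess_nd.
    apply: nearW => n; rewrite -EFin_Ex; last exact: (itgB (phi_itg n) i0).
    by rewrite (ExB (phi_itg n) i0) lee_fin lerD2r; exact: phic.
  - by move=> n; apply/measurable_EFinP; apply: measurable_funB; exact: measurable_v.
  - by move=> n w _; rewrite lee_fin subr_ge0; exact: phi_nd.
have iexcess : P.-integrable setT excess.
  apply/integrableP; split => //.
  under eq_integral do rewrite gee0_abs//.
  by apply: le_lt_trans intE _; rewrite ltry.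
rewrite /Hcond (@ae_eq_integral _ _ _ P setT (fun w => excess w + (phi 0%N w)%:E)%E)//.
- rewrite integralD//; apply: le_trans (leeD2r _ intE) _.
  by rewrite -EFin_Ex// -EFinD subrK.
- exact: emeasurable_funD.
- by apply: filterS conj_tildeE => w ->.
Qed.

End fixed_arguments.

End conjugate_integral.

(** * Reduction to a finite integrand *)

Section finite_version.
Context {d : measure_display} {T : measurableType d} {R : realType}.
Variables (P : probability T R) (gamma : acprob P -> \bar R).
Hypothesis gamma_penalty : penalty gamma.

Lemma expectation_le_rho (X : T -> R) (Q : acprob P) (c : R) :
  Qgamma gamma Q -> (rho gamma X <= c%:E)%E ->
  ('E_Q[X] <= c%:E + (gam gamma Q)%:E)%E.
Proof.
move=> gQ Xc; rewrite -leeBlDr//; apply: le_trans Xc.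
by apply: ereal_sup_ubound; exists Q => //; rewrite (gamE gamma_penalty gQ).
Qed.

Lemma ge0_itg (mu : probability T R) (X : T -> R) (c : R) :
  measurable_fun setT X -> (forall w, 0 <= X w) -> ('E_mu[X] <= c%:E)%E ->
  itg mu X /\ Ex mu X <= c.
Proof.
move=> mX X0 Xc; have iX : itg mu X.
  apply/integrableP; split; first exact/measurable_EFinP.
  under eq_integral do rewrite /= ger0_norm//.
  by rewrite unlock in Xc; apply: le_lt_trans Xc _; rewrite ltry.
by split => //; rewrite -lee_fin -EFin_expectation.
Qed.

Lemma Lrho_itg (eta : {mfun T >-> R}) (Q : acprob P) :
  Lrho gamma eta -> Qgamma gamma Q -> itg Q eta.
Proof.
move=> [al al0 rho_lt] gQ.
have rho_fin : (rho gamma (fun w => al * `|eta w|)%R <=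
    (fine (rho gamma (fun w => al * `|eta w|)%R))%:E)%E.
  by move: rho_lt; case: (rho _ _) => [r| |] //= _; rewrite leNye.
have meta : measurable_fun setT eta by [].
have [||iX _] := ge0_itg _ _ (expectation_le_rho gQ rho_fin).
- by apply: measurable_funM => //; exact: measurableT_comp.
- by move=> w; rewrite mulr_ge0// ltW.
apply: (itg_dominated meta (itgZ al^-1 iX)); apply: nearW => w.
by rewrite mulrA mulVf ?mul1r// lt0r_neq0.
Qed.

(** Convergence to 0 is used only through the value of rho being eventually at
    most 1. *)
Lemma Mrho_u_controlled (xi : {mfun T >-> R}) :
  Mrho_u gamma xi -> excess_controlled gamma xi.
Proof.
move=> xiM al al0; have mxi : measurable_fun setT xi by [].
have /fine_cvgP[finN /cvgrPdist_lt/(_ _ ltr01) rho1] := xiM al al0.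
have [N _ /(_ N (leqnn N))/=[fN]] := filterI finN rho1.
rewrite sub0r normrN => rN.
exists N%:R => // Q gQ.
set X := fun w => (al * `|xi w| * _)%R in fN rN.
have X1 : (rho gamma X <= 1%:E)%E.
  by rewrite -(fineK fN) lee_fin; apply/ltW/(le_lt_trans (ler_norm _)).
have mA : measurable [set w | N%:R < `|xi w|].
  rewrite (_ : [set _ | _] = (fun w => `|xi w|) @^-1` `]N%:R, +oo[); last first.
    by apply/seteqP; split => w /=; rewrite in_itv/= andbT.
  rewrite -[X in measurable X]setTI.
  have mn : measurable_fun setT (fun w => `|xi w|) by exact: measurableT_comp.
  exact: mn.
have mX : measurable_fun setT X.
  apply: measurable_funM; last exact: measurable_indic.
  by apply: measurable_funM => //; exact: measurableT_comp.
have [|iX XE] := ge0_itg mX _ (expectation_le_rho gQ X1).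
  by move=> w; rewrite /X mulr_ge0// mulr_ge0// ltW.
have XN w : al * Num.max (`|xi w| - N%:R) 0 <= X w.
  rewrite /X indicE; case: (boolP (w \in _)) => h.
    rewrite mulr1 ler_pM2l// ge_max normr_ge0 andbT.
    by rewrite gerBl.
  have le : `|xi w| <= N%:R.
    by rewrite leNgt; apply/negP => lt; move/negP: h; apply; exact: mem_set.
  by rewrite mulr0 (max_idPr _) ?mulr0// subr_le0.
have ixi : itg Q xi.
  apply: (itg_dominated mxi (itgD (itg_cst Q N%:R) (itgZ al^-1 iX))); apply: nearW => w.
  have h1 : `|xi w| - N%:R <= Num.max (`|xi w| - N%:R) 0 by rewrite le_max lexx.
  have : Num.max (`|xi w| - N%:R) 0 <= al^-1 * X w by rewrite ler_pdivlMl.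
  lra.
split => //; apply: le_trans XE.
have iE := itg_excess N%:R ixi.
rewrite -ExZ//; apply: ae_le_Ex => //; first exact: itgZ.
apply: nearW => w; apply: le_trans (XN w); rewrite ler_pM2l//.
rewrite ge_max; apply/andP; split; last by rewrite le_max lexx orbT.
by rewrite le_max lerD2r ler_norm.
Qed.

(** Finiteness at the integers almost everywhere gives finiteness everywhere by
    convexity; on the exceptional null set g is set to 0.  The lower bound is the
    Fenchel-Young inequality at eta0. *)
Lemma exists_finite_integrand (f : T -> R -> \bar R) :
  normal_convex_integrand P f ->
  (forall x : R, ae_in P (Mrho_u gamma) (fun w => f w x)^\+%E) ->
  (exists2 eta0 : {mfun T >-> R}, Lrho gamma eta0 &
     ae_in P (Lrho gamma) (fun w => fconj f w (eta0 w))^\+%E) ->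
  exists2 g : T -> R -> R, finite_integrand gamma g &
    \forall w \ae P, forall x, f w x = (g w x)%:E.
Proof.
move=> fn fM [eta0 eta0L [b bL bE]].
have fin_at (x : R) : \forall w \ae P, (f w x < +oo)%E.
  have [xi _] := fM x; apply: filterS => w.
  rewrite funeposE => h; apply: (@le_lt_trans _ _ (maxe (f w x) 0%E)).
    by rewrite le_max lexx.
  by rewrite h ltry.
have fin_pos : \forall w \ae P, forall n : nat, (f w n%:R < +oo)%E.
  by apply/ae_foralln => n; exact: fin_at.
have fin_neg : \forall w \ae P, forall n : nat, (f w (- n%:R)%R < +oo)%E.
  by apply/ae_foralln => n; exact: fin_at.
have fin_all : \forall w \ae P, forall x, f w x \is a fin_num.
  apply: filterS3 fin_pos fin_neg (integrand_convex fn) => w wp wn cvx x.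
  rewrite fin_numElt (integrand_gtNy fn)/=.
  pose n := (Num.truncn `|x|).+1.
  have xn : `|x| < n%:R by rewrite truncnS_gt.
  move: xn; rewrite ltr_norml => /andP[nx xn].
  have n0 : (0 : R) < n%:R by rewrite ltr0n.
  pose t := (x + n%:R) / (2 * n%:R).
  have tn : t * (2 * n%:R) = x + n%:R by rewrite divfK// mulf_neq0// lt0r_neq0.
  have t0 : 0 <= t by rewrite divr_ge0//; lra.
  have t1 : t <= 1 by rewrite ler_pdivrMr; lra.
  have -> : x = t * n%:R + (1 - t) * - n%:R by lra.
  apply: le_lt_trans (cvx _ _ t _) _; first by rewrite t0.
  move: (wp n) (wn n) (integrand_gtNy fn w n%:R) (integrand_gtNy fn w (- n%:R)).
  by case: (f w n%:R) => [r1| |]//; case: (f w (- n%:R)) => [r2| |]// _ _ _ _;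
    rewrite -!EFinM -EFinD ltry.
have [N [mN PN0 Ngood]] : \forall w \ae P, [/\ econvex (f w),
    forall x, f w x \is a fin_num &
    forall x, ((x * eta0 w)%:E - f w x <= (b w)%:E)%E].
  apply: filterS3 fin_all (integrand_convex fn) bE => w wf wc wb.
  split => // x; rewrite -wb funeposE le_max; apply/orP; left.
  by apply: ereal_sup_ubound; exists x.
have good w : ~ N w -> [/\ econvex (f w), forall x, f w x \is a fin_num &
    forall x, ((x * eta0 w)%:E - f w x <= (b w)%:E)%E].
  by move=> nN; apply: contrapT => h; apply: nN; exact: Ngood.
pose g w (x : R) : R := \1_(~` N) w * fine (f w x).
have gN w x : N w -> g w x = 0.
  by move=> Nw; rewrite /g indicE memNset ?mul0r//= => /(_ Nw).
have gE w x : ~ N w -> g w x = fine (f w x).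
  by move=> Nw; rewrite /g indicE mem_set ?mul1r.
have fgE w x : ~ N w -> f w x = (g w x)%:E.
  by move=> Nw; rewrite gE// fineK//; have [_] := good w Nw.
have fg : \forall w \ae P, forall x, f w x = (g w x)%:E.
  exists N; split => // w /= h; apply: contrapT => Nw; apply: h => x.
  exact: fgE.
have mg (xi : T -> R) : measurable_fun setT xi ->
    measurable_fun setT (fun w => g w (xi w)).
  move=> mxi; apply: measurable_funM.
    by apply: measurable_indic; exact: measurableC.
  apply: (measurableT_comp (fine_measurable measurableT)) => //.
  have mid : measurable_fun setT (fun w : T => w) by exact: measurable_id.
  exact: (measurableT_comp (integrand_measurable fn) (measurable_fun_pair mid mxi)).
exists g => //; split => //.
- move=> w x y t t01; have [Nw|Nw] := pselect (N w).
    by rewrite !gN// !mulr0 addr0.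
  have [cvx _ _] := good w Nw.
  by have := cvx x y t t01; rewrite !fgE// -!EFinM -EFinD lee_fin.
- move=> x; have [xi xiM xiE] := fM x.
  apply: (ae_excess_controlled _ _ (Mrho_u_controlled xiM)).
    by apply: measurable_maxr => //; exact: (mg (cst x)).
  apply: filterS2 fg xiE => w wg; rewrite funeposE wg -EFin_max => -[] //.
exists (fun w => `|eta0 w|), (fun w => `|b w|); split => //.
  by move=> Q gQ; split; apply: itg_norm; exact: Lrho_itg.
move=> w x; have [Nw|Nw] := pselect (N w).
  by rewrite gN// oppr_le0 addr_ge0// mulr_ge0.
have [_ _ /(_ x)] := good w Nw; rewrite fgE// -EFinB lee_fin => h.
have h1 := ler_norm (b w).
have h2 : - (x * eta0 w) <= `|x| * `|eta0 w|.
  by rewrite -normrM -normrN; exact: ler_norm.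
lra.
Qed.

End finite_version.

(** * Weak and strong duality *)

Section duality.
Context {d : measure_display} {T : measurableType d} {R : realType}.
Variables (P : probability T R) (gamma : acprob P -> \bar R).
Hypothesis P_complete : measure_is_complete P.
Hypothesis gamma_penalty : penalty gamma.
Variables (f : T -> R -> \bar R) (g : T -> R -> R).
Hypothesis g_integrand : finite_integrand gamma g.
Hypothesis fg : \forall w \ae P, forall x, f w x = (g w x)%:E.
Variable C : set (Linf P).
Local Open Scope ereal_scope.

Let J (xi : T -> R) (Q : acprob P) := Jfun g xi Q.
Let pr (xi : Linf P) (eta : L1 P) : R := Ex P (fun w => xi w * eta w)%R.

Lemma expectation_pairing (xi : Linf P) (eta : L1 P) :
  'E_P[(xi \* eta)%R] = (pr xi eta)%:E.
Proof. by rewrite EFin_expectation//; exact: Linf_itgM (L1_itg eta). Qed.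

Let prN (xi : Linf P) (eta : L1 P) : pr xi (- eta)%R = (- pr xi eta)%R.
Proof.
rewrite /pr -ExN; last exact: Linf_itgM (L1_itg eta).
congr (Ex P _); apply/funext => w.
have -> : (- eta)%R w = (- eta w)%R by [].
by rewrite mulrN.
Qed.

Lemma IfunE (xi : Linf P) : Ifun f gamma xi =
  ereal_sup [set (J xi Q - gam gamma Q)%:E | Q in Qgamma gamma].
Proof.
have E Q : Qgamma gamma Q -> \int[Q]_w f w (xi w) - gamma Q = (J xi Q - gam gamma Q)%:E.
  move=> gQ; have i := integrand_Linf_itg g_integrand xi gQ.
  have mg : measurable_fun setT (fun w => (g w (xi w))%:E) := measurable_int _ i.
  rewrite (gamE gamma_penalty gQ) EFinB /J /Jfun EFin_Ex//; congr (_ - _).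
  apply: ae_eq_integral => //.
    apply: (ae_measurable_fun P_complete _ mg).
    by apply: filterS fg => w fgw _; rewrite fgw.
  by apply: filterS (@acprob_ae _ _ _ _ Q _ fg) => w fgw _; rewrite fgw.
rewrite /Ifun; congr ereal_sup; apply/seteqP.
by split => _ [Q gQ <-]; exists Q; rewrite ?E.
Qed.

Lemma Ifun_ge (xi : Linf P) (Q : acprob P) : Qgamma gamma Q ->
  (J xi Q - gam gamma Q)%:E <= Ifun f gamma xi.
Proof. by move=> gQ; rewrite IfunE; apply: ereal_sup_ubound; exists Q. Qed.

(** The excess of the envelope is at most 1 plus the penalty, so subtracting the
    penalty leaves a constant. *)
Lemma Ifun_lty (xi : Linf P) : Ifun f gamma xi < +oo.
Proof.
have [k _ xik] := Linf_bounded xi.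
have [N N0 NP] := envelope_controlled g_integrand k ltr01.
apply: (@le_lt_trans _ _ (N + 1)%:E); last by rewrite ltry.
rewrite IfunE; apply: ge_ereal_sup => _ [Q gQ <-]; rewrite lee_fin.
have [iG eG] := NP Q gQ; have h := Ex_le_excess N iG.
have h' : (J xi Q <= Ex Q (envelope g k))%R.
  apply: ae_le_Ex => //; first exact: (integrand_Linf_itg g_integrand).
  by apply: filterS (@acprob_ae _ _ _ _ Q _ xik) => w; exact: (le_envelope g_integrand).
lra.
Qed.

Lemma Hfun_ge (eta : L1 P) (xi : Linf P) :
  (- pr xi eta)%:E - Ifun f gamma xi <= Hfun f gamma (- eta)%R.
Proof.
apply: le_ereal_inf_tmp => _ [Q gQ <-].
have := Hcond_ge P_complete g_integrand fg (- eta)%R gQ xi.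
rewrite -/(pr _ _) prN (gamE gamma_penalty gQ) => h.
apply: (@le_trans _ _ ((- pr xi eta - J xi Q)%:E + (gam gamma Q)%:E)); last exact: leeD2r.
rewrite -EFinD -addrA EFinD leeD2l// -[leRHS]oppeK leeN2 -EFinN opprD opprK.
exact: Ifun_ge.
Qed.

Lemma support_fun_ge (xi : Linf P) (eta : L1 P) :
  C xi -> (pr xi eta)%:E <= support_fun C eta.
Proof.
by move=> Cxi; rewrite -expectation_pairing; apply: ereal_sup_ubound; exists xi.
Qed.

Hypothesis C_nonempty : C !=set0.

Lemma Hfun_gtNy (eta : L1 P) : -oo < Hfun f gamma (- eta)%R.
Proof.
have [xi Cxi] := C_nonempty; apply: lt_le_trans (Hfun_ge eta xi).
by have := Ifun_lty xi; case: (Ifun f gamma xi) => [r| |] //= _; rewrite -EFinD ltNyr.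
Qed.

Lemma weak_duality (eta : L1 P) :
  - ereal_inf [set Ifun f gamma xi | xi in C] <=
  Hfun f gamma (- eta)%R + support_fun C eta.
Proof.
rewrite leeNl; apply: le_ereal_inf_tmp => _ [xi Cxi <-].
rewrite leeNl.
apply: (@le_trans _ _ ((- pr xi eta)%:E - Ifun f gamma xi + (pr xi eta)%:E)).
  by case: (Ifun f gamma xi) => [r| |]//=; rewrite -!EFinD lee_fin; lra.
by apply: leeD; [exact: Hfun_ge|exact: support_fun_ge].
Qed.

Hypothesis C_convex : forall xi1 xi2 (t : R), C xi1 -> C xi2 -> (0 <= t <= 1)%R ->
  C (t *: xi1 + (1 - t) *: xi2)%R.

(** When the infimum is -oo the bound is +oo and any eta will do.  The infimum is
    never +oo, so otherwise it is a real number and [dual_attained] applies. *)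
Lemma strong_duality : exists eta : L1 P,
  Hfun f gamma (- eta)%R + support_fun C eta <=
  - ereal_inf [set Ifun f gamma xi | xi in C].
Proof.
have [xi0 Cxi0] := C_nonempty.
have inf_lty : ereal_inf [set Ifun f gamma xi | xi in C] < +oo.
  by apply: le_lt_trans (Ifun_lty xi0); apply: ereal_inf_lbound; exists xi0.
move E : (ereal_inf _) inf_lty => m; case: m E => [m| |]// E _; last first.
  by exists 0%R; rewrite leey.
have [|eta [Q [gQ etaQ]]] :=
    dual_attained gamma_penalty g_integrand C_nonempty C_convex (m := m).
  move=> xi Cxi m' m'm.
  have : m'%:E < Ifun f gamma xi.
    apply: (@lt_le_trans _ _ m%:E); first by rewrite lte_fin.
    by rewrite -E; apply: ereal_inf_lbound; exists xi.
  by rewrite IfunE => /ereal_sup_gt[_ [Q gQ <-]]; rewrite lte_fin; exists Q.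
exists eta.
have H_le xi : C xi ->
    Hcond f (- eta)%R Q + (gam gamma Q)%:E <= (- m - pr xi eta)%:E.
  move=> Cxi; rewrite -leeBrDr// -EFinB.
  apply: (Hcond_le P_complete g_integrand fg gQ) => xi'.
  have := etaQ xi xi' Cxi; rewrite -!/(pr _ _) prN.
  by rewrite -/(J _ _); lra.
have H_ge := Hcond_ge P_complete g_integrand fg (- eta)%R gQ xi0.
have Hfin : Hcond f (- eta)%R Q \is a fin_num.
  rewrite fin_numElt (lt_le_trans _ H_ge) ?ltNyr//=.
  by have := H_le xi0 Cxi0; case: (Hcond _ _ _) => [r _| |] //=; rewrite ?ltry ?addye.
have Hle : Hfun f gamma (- eta)%R <= Hcond f (- eta)%R Q + (gam gamma Q)%:E.
  by apply: ereal_inf_lbound; exists Q => //; rewrite (gamE gamma_penalty gQ).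
rewrite -(fineK Hfin) -EFinD in Hle H_le.
have Sle : support_fun C eta <= (- m - (fine (Hcond f (- eta)%R Q) + gam gamma Q))%:E.
  apply: ge_ereal_sup => _ [xi Cxi <-]; rewrite expectation_pairing.
  by have := H_le xi Cxi; rewrite !lee_fin; lra.
apply: le_trans (leeD Hle Sle) _.
by rewrite -EFinD -EFinN lee_fin; lra.
Qed.

Hypothesis C_cone : cone C.

Let prZ (t : R) (xi : Linf P) eta : pr (t *: xi)%R eta = (t * pr xi eta)%R.
Proof.
rewrite /pr -ExZ; last exact: Linf_itgM (L1_itg eta).
congr (Ex P _); apply/funext => w.
have -> : (t *: xi)%R w = (t * xi w)%R by [].
by rewrite mulrA.
Qed.

(** Scaling improves the bound 1 to 0, and scaling by small factors shows that the
    supremum 0 is approached even if the cone does not contain 0. *)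
Lemma support_fun_polar (eta : L1 P) : polar C eta -> support_fun C eta = 0.
Proof.
move=> Ceta; have [xi0 Cxi0] := C_nonempty.
have pr_le1 xi : C xi -> (pr xi eta <= 1)%R.
  by move=> /Ceta; rewrite expectation_pairing lee_fin.
have pr_le0 xi : C xi -> (pr xi eta <= 0)%R.
  move=> Cxi; rewrite leNgt; apply/negP => pr0.
  have t0 : (0 < 2 / pr xi eta)%R by rewrite divr_gt0.
  have := pr_le1 _ (C_cone t0 Cxi); rewrite prZ divfK ?lt0r_neq0//; lra.
apply/eqP; rewrite eq_le; apply/andP; split.
  apply: ge_ereal_sup => _ [xi Cxi <-].
  by rewrite expectation_pairing lee_fin; exact: pr_le0.
apply/lee_addgt0Pr => e e0.
have n1 : (0 < `|pr xi0 eta| + 1)%R by rewrite ltr_wpDl.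
have t0 : (0 < e / (`|pr xi0 eta| + 1))%R by rewrite divr_gt0.
apply: le_trans (leeD2r _ (support_fun_ge eta (C_cone t0 Cxi0))).
rewrite prZ -EFinD lee_fin.
have tE : (e / (`|pr xi0 eta| + 1) * (`|pr xi0 eta| + 1) = e)%R.
  by rewrite divfK// lt0r_neq0.
have := ler_norm (- pr xi0 eta); rewrite normrN.
set t := (e / _)%R in t0 tE *; nra.
Qed.

Lemma support_fun_not_polar (eta : L1 P) : ~ polar C eta -> support_fun C eta = +oo.
Proof.
move=> /existsNP[xi /not_implyP[Cxi /negP]].
rewrite -ltNge expectation_pairing lte_fin => pr1.
apply/eqyP => A A0; apply: le_trans (support_fun_ge eta (C_cone A0 Cxi)).
by rewrite prZ lee_fin ler_peMr// ltW.
Qed.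

Lemma polar0 : polar C 0%R.
Proof.
move=> xi _; rewrite expectation_pairing /pr.
have -> : (fun w => xi w * (0 : L1 P)%R w)%R = (fun=> 0%R).
  by apply/funext => w; rewrite -[RHS](mulr0 (xi w)).
by rewrite Ex_cst lee_fin.
Qed.

End duality.

Local Open Scope ereal_scope.

Theorem corollary3p7 (d : measure_display) (T : measurableType d)
  (R : realType) (P : probability T R) (P_complete : measure_is_complete P)
  (gamma : acprob P -> \bar R) (gamma_penalty : penalty gamma)
  (f : T -> R -> \bar R) (f_normal : normal_convex_integrand P f)
  (f_Mrho : forall x : R, ae_in P (Mrho_u gamma) (fun w => f w x)^\+)
  (f_conj : exists2 eta0 : {mfun T >-> R}, Lrho gamma eta0 &
     ae_in P (Lrho gamma) (fun w => fconj f w (eta0 w))^\+)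
  (C : set (Linf P)) (C_nonempty : C !=set0)
  (C_convex : convex_set (C : set (convex_lmodType (Linf P)))) :
  exists m : \bar R,
    [/\ is_min [set: L1 P]
          (fun eta => Hfun f gamma (- eta)%R + support_fun C eta) m,
        ereal_inf [set Ifun f gamma xi | xi in C] = - m
      & cone C -> is_min (polar C) (fun eta => Hfun f gamma (- eta)%R) m].
Proof.
have [g g_integrand fg] := exists_finite_integrand gamma_penalty f_normal f_Mrho f_conj.
have Ccvx xi1 xi2 (t : R) : C xi1 -> C xi2 -> (0 <= t <= 1)%R ->
    C (t *: xi1 + (1 - t) *: xi2)%R.
  move=> C1 C2 /andP[t0 t1].
  have := C_convex xi1 xi2 (Itv01 t0 t1) (mem_set C1) (mem_set C2).
  by move=> /set_mem.
have weak := weak_duality P_complete gamma_penalty g_integrand fg.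
have [eta etaP] := strong_duality P_complete gamma_penalty g_integrand fg C_nonempty Ccvx.
set m := (- ereal_inf _)%E in weak etaP.
have etaE : (Hfun f gamma (- eta)%R + support_fun C eta)%E = m.
  by apply/eqP; rewrite eq_le etaP weak.
exists m; split; [split| |].
- apply/eqP; rewrite eq_le; apply/andP; split.
    by rewrite -etaE; apply: ereal_inf_lbound; exists eta.
  by apply: le_ereal_inf_tmp => _ [eta' _ <-]; exact: weak.
- by exists eta.
- by rewrite /m oppeK.
move=> Ccone.
have polarE eta' : polar C eta' ->
    (Hfun f gamma (- eta')%R + support_fun C eta')%E = Hfun f gamma (- eta')%R.
  by move=> Ceta'; rewrite (support_fun_polar C_nonempty Ccone Ceta') adde0.
have weak_polar eta' : polar C eta' -> (m <= Hfun f gamma (- eta')%R)%E.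
  by move=> Ceta'; rewrite -polarE//; exact: weak.
have [eta1 C1 eta1E] : exists2 eta1, polar C eta1 & Hfun f gamma (- eta1)%R = m.
  have [Ceta|nCeta] := pselect (polar C eta); first by exists eta => //; rewrite -polarE.
  exists 0%R; first exact: polar0.
  have my : m = +oo%E.
    rewrite -etaE (support_fun_not_polar Ccone nCeta) addey// -ltNye.
    exact: (Hfun_gtNy P_complete gamma_penalty g_integrand fg C_nonempty).
  by apply/eqP; rewrite my -leye_eq -my weak_polar//; exact: polar0.
split; last by exists eta1.
apply/eqP; rewrite eq_le; apply/andP; split.
  by rewrite -eta1E; apply: ereal_inf_lbound; exists eta1.
by apply: le_ereal_inf_tmp => _ [eta' Ceta' <-]; exact: weak_polar.
Qed.
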